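(* For $\mathbf u_1,\mathbf u_2\in H_e^1$, $$\mathcal M\mathbf u_1=\mathcal M\mathbf u_2\quad\Longleftrightarrow\quad\nabla\!\cdot(\mathbf u_1-\mathbf u_2)=0 .$$
   Context: Write $\mathbf x=(\mathbf x',x_3)\in\mathbb R^3$ with $\mathbf x'=(x_1,x_2)$. $B(\mathbf x',r)$ is the open ball in $\mathbb R^3$ with center $(\mathbf x',0)$ and radius $r$. Symmetry class: $\sigma(\mathbf x',x_3)=(\mathbf x',-x_3)$, $J=\operatorname{diag}(1,1,-1)$, and $H_e^1=\{\mathbf u\in H^1(\mathbb R^3;\mathbb R^3):\mathbf u(\sigma\mathbf x)=J\mathbf u(\mathbf x)\text{ for a.e. }\mathbf x\}$, with $H^1$ the usual $L^2$-based Sobolev space of real vector fields. Forward operator: for $\mathbf u\in H_e^1$, $$(\mathcal M\mathbf u)(\mathbf x',r)=-\frac1{r^4}\int_{B(\mathbf x',r)}\nabla\!\cdot\mathbf u(\mathbf y)\,d\mathbf y,\qquad(\mathbf x',r)\in\mathbb R^2\times(0,\infty).$$ Data on the full domain $\mathbb R^2\times(0,\infty)$ are compared as functions almost everywhere, and the divergence is an element of $L^2(\mathbb R^3)$. *)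

(* Defs.v *)
From HB Require Import structures.
From mathcomp Require Export all_boot all_order all_algebra.
From mathcomp Require Export all_classical all_reals all_analysis.

Set Implicit Arguments.
Unset Strict Implicit.
Unset Printing Implicit Defensive.

Export Order.TTheory GRing.Theory Num.Theory.
Export numFieldNormedType.Exports.

#[global] Open Scope classical_set_scope.
#[global] Open Scope ring_scope.

Notation R3 R := (R * R * R)%type (only parsing).

Section Sobolev.
Context {R : realType}.

Definition coord (i : 'I_3) (x : R3 R) : R :=
  tnth [tuple x.1.1; x.1.2; x.2] i.

Definition basis3 (i : 'I_3) : R3 R :=
  ((i == 0%N :> nat)%:R, (i == 1%N :> nat)%:R, (i == 2%N :> nat)%:R).

(* The library's norm and balls on a product are those of the sup norm. *)
Definition enorm (x : R3 R) : R := Num.sqrt (\sum_(i < 3) coord i x ^+ 2).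

Definition eball (c : R3 R) (r : R) : set (R3 R) :=
  [set y | enorm (y - c) < r].

(* Lebesgue measure on the Borel sets of R^3: every class of Lebesgue
   measurable functions modulo a.e. equality has a Borel representative. *)
Definition leb3 : {measure set
    (measurableTypeR R * measurableTypeR R * measurableTypeR R)%type
    -> \bar R} :=
  (@lebesgue_measure R \x @lebesgue_measure R \x @lebesgue_measure R)%E.

Definition partial (i : 'I_3) (f : R3 R -> R) : R3 R -> R :=
  fun x => 'D_(basis3 i) f x.

Fixpoint Ck (k : nat) (f : R3 R -> R) : Prop :=
  continuous f /\
  if k is k'.+1 then
    forall i : 'I_3, (forall x, derivable f x (basis3 i)) /\ Ck k' (partial i f)
  else True.

Definition test_function (phi : R3 R -> R) : Prop :=
  (forall k, Ck k phi) /\ compact (closure [set x | phi x != 0]).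

Definition L2 (f : R3 R -> R) : Prop := f \in Lfun leb3 2%:E.

Definition is_weak_partial (i : 'I_3) (f g : R3 R -> R) : Prop :=
  forall phi, test_function phi ->
    \int[leb3]_x (f x * partial i phi x) = - \int[leb3]_x (g x * phi x).

(* A representative of the weak derivative, which is unique a.e.; the default
   value 0 is only used when there is no weak derivative in L^2. *)
Definition weak_partial (i : 'I_3) (f : R3 R -> R) : R3 R -> R :=
  xget (fun=> 0) [set g | L2 g /\ is_weak_partial i f g].

Definition component (i : 'I_3) (u : R3 R -> R3 R) : R3 R -> R :=
  fun x => coord i (u x).

Definition sobolevH1 (u : R3 R -> R3 R) : Prop :=
  forall i : 'I_3, L2 (component i u) /\
    forall j : 'I_3, exists g, L2 g /\ is_weak_partial j (component i u) g.

(* The reflection sigma; its matrix is J = diag(1, 1, -1). *)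
Definition reflect3 (x : R3 R) : R3 R := (x.1, - x.2).

Definition sobolevH1e (u : R3 R -> R3 R) : Prop :=
  sobolevH1 u /\ {ae leb3, forall x, u (reflect3 x) = reflect3 (u x)}.

Definition weak_div (u : R3 R -> R3 R) : R3 R -> R :=
  fun x => \sum_(i < 3) weak_partial i (component i u) x.

(* The argument (x', r) of the data is a point of R^2 x R. *)
Definition forward (u : R3 R -> R3 R) (p : R3 R) : R :=
  - (p.2 ^+ 4)^-1 * \int[leb3]_(y in eball (p.1, 0) p.2) weak_div u y.

Definition data_domain : set (R3 R) := [set p | 0 < p.2].

End Sobolev.

(* Main.v *)
From HB Require Import structures.
Require Import Defs.
From mathcomp Require Import ring lra measurable_realfun.

(** Linearity reduces the equivalence to a uniqueness statement: if f in L^2(R^3) is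
    even in the last variable and has integral zero over almost every ball centred
    on the plane x3 = 0, then f = 0 almost everywhere. Here f is the difference of
    the two divergences; the converse implication is immediate.

    Uniqueness is proved through Gaussians. Integrating the ball condition against
    2 t r exp(-t r^2) dr turns it into the vanishing of the integrals of
    f(y) exp(-t |y - c|^2), for all t > 0 and almost every c in the plane
    (gaussian_of_eball), hence for every c by continuity (gaussian_ae_all). In
    contrast with balls, these Gaussians are stable under products up to constants,
    since completing the square keeps the centre on the plane (gaussianM). So f is
    still orthogonal to them after multiplication by a polynomial in a Gaussian.
    Such polynomials converge boundedly to the indicator of the exterior of any
    ball centred on the plane (soft_threshold_cvg), so f may be cut by such sets.
    The sets by which it may be cut form a sigma-algebra
    (cut_stable_sigma_algebra). That sigma-algebra makes every |y - c|^2 measurable,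
    hence also y1, y2 and |y3|, of which an even f is a function. It therefore
    contains the sets where f > 0 and where f < 0, and cutting by these forces
    f = 0 (even_eq0_gaussian).

    Two facts about weak derivatives are used besides. They are unique almost
    everywhere (weak_partial_unique), so the divergence is linear although the weak
    derivatives are chosen representatives (weak_divB). And the divergence of a
    field of the symmetry class is even (weak_div_even), since composing with the
    reflection maps weak derivatives of its components to weak derivatives.
    Uniqueness rests on the same cutting argument, with test functions as weights
    and smooth steps in one coordinate as cutting functions (ae_eq0_test). *)

Set Implicit Arguments.
Unset Strict Implicit.
Unset Printing Implicit Defensive.

(** * Orthogonality to a family of weights *)

Lemma ae_eq_Rintegral d (T : measurableType d) (R : realType)
    (mu : {measure set T -> \bar R}) (f g : T -> R) :
  measurable_fun setT f -> measurable_fun setT g ->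
  {ae mu, forall x, f x = g x} -> \int[mu]_x f x = \int[mu]_x g x.
Proof.
move=> mf mg fg; rewrite /Rintegral; congr fine; apply: ae_eq_integral => //.
- exact/measurable_EFinP.
- exact/measurable_EFinP.
- by apply: filterS fg => x -> _.
Qed.

Lemma Rintegral_indic d (T : measurableType d) (R : realType)
    (mu : {measure set T -> \bar R}) (D : set T) (f : T -> R) :
  \int[mu]_(x in D) f x = \int[mu]_x (f x * \1_D x).
Proof.
rewrite Rintegral_mkcond; apply: eq_Rintegral => x _.
by rewrite patchE indicE; case: ifP => _; rewrite ?mulr1 ?mulr0.
Qed.

Section Annihilator.
Context d (T : measurableType d) (R : realType) (mu : {measure set T -> \bar R}).
Context (f : T -> R) (Phi : set (T -> R)).

Definition bounded_measurable (h : T -> R) :=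
  measurable_fun setT h /\ exists M, forall x, `|h x| <= M.

(** The weights will be the test functions, then the Gaussians centred on the plane. *)
Definition annihilates (h : T -> R) := bounded_measurable h /\
  forall phi, Phi phi -> \int[mu]_x (f x * phi x * h x) = 0.

(** Closing this under intersection needs no argument, because the condition
    quantifies over all [h]; that is why it is not merely asked of [h = 1]. *)
Definition cut_stable (A : set T) := measurable A /\
  forall h, annihilates h -> annihilates (h \* \1_A).

Lemma integral_EFin_eq0 (g : T -> R) : mu.-integrable setT (EFin \o g) ->
  \int[mu]_x g x = 0 -> (\int[mu]_x (g x)%:E = 0)%E.
Proof.
move=> ig g0; rewrite -(fineK (integrable_fin_num measurableT ig)).
by congr EFin.
Qed.

Lemma Rdominated_eq0 (F_ : nat -> T -> R) (F G : T -> R) :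
    (forall n, measurable_fun setT (F_ n)) ->
    (forall x, F_ ^~ x @ \oo --> F x) ->
    mu.-integrable setT (EFin \o G) ->
    (forall n x, `|F_ n x| <= G x) ->
    (forall n, \int[mu]_x F_ n x = 0) ->
  \int[mu]_x F x = 0.
Proof.
move=> mF cF iG FG F0.
have iF n : mu.-integrable setT (EFin \o F_ n).
  apply: le_integrable iG => //; first exact/measurable_EFinP.
  by move=> x _ /=; rewrite lee_fin (le_trans (FG n x))// ler_norm.
have cI : (\int[mu]_x (F_ n x)%:E)%E @[n --> \oo] --> (\int[mu]_x (F x)%:E)%E.
  apply: (@dominated_cvg _ _ _ mu _ measurableT (fun n => EFin \o F_ n)
    (EFin \o F) (EFin \o G)) => //.
  - by move=> n; exact/measurable_EFinP.
  - move=> x _ /=; apply: cvg_EFin; first by apply: nearW.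
    exact: cF.
  - by move=> n x _ /=; rewrite lee_fin.
have I0 n : (\int[mu]_x (F_ n x)%:E = 0)%E.
  exact: integral_EFin_eq0.
rewrite /Rintegral -(cvg_lim _ cI)//.
by under eq_fun do rewrite I0; rewrite lim_cst.
Qed.

Hypothesis fPhi : forall phi, Phi phi -> mu.-integrable setT (EFin \o (f \* phi)).

Lemma bounded_measurableM g h : bounded_measurable g -> bounded_measurable h ->
  bounded_measurable (g \* h).
Proof.
move=> [mg [M gM]] [mh [N hN]]; split; first exact: measurable_funM.
by exists (M * N) => x /=; rewrite normrM ler_pM.
Qed.

Lemma bounded_measurableD g h : bounded_measurable g -> bounded_measurable h ->
  bounded_measurable (g \+ h).
Proof.
move=> [mg [M gM]] [mh [N hN]]; split; first exact: measurable_funD.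
by exists (M + N) => x /=; rewrite (le_trans (ler_normD _ _))// lerD.
Qed.

Lemma bounded_measurableZ c h : bounded_measurable h ->
  bounded_measurable (fun x => c * h x).
Proof.
move=> [mh [N hN]]; split; first exact: measurable_funM.
by exists (`|c| * N) => x /=; rewrite normrM ler_wpM2l.
Qed.

Lemma integrable_bounded_mul phi h : Phi phi -> bounded_measurable h ->
  mu.-integrable setT (EFin \o (fun x => f x * phi x * h x)).
Proof.
move=> /fPhi ifp [mh [M hM]].
apply: (@le_integrable _ _ _ _ _ measurableT _
  (EFin \o (fun x => M * (f \* phi) x))).
- apply/measurable_EFinP; apply: measurable_funM => //.
  by apply/measurable_EFinP; exact: measurable_int ifp.
- move=> x _ /=; rewrite lee_fin (mulrC _ (h x)) !(normrM _ (f x * phi x)).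
  rewrite ler_wpM2r//.
  by rewrite (le_trans (hM x)) ?ler_norm.
- exact: (@integrableZl _ _ _ mu setT measurableT M (EFin \o (f \* phi))).
Qed.

Lemma annihilatesD g h : annihilates g -> annihilates h -> annihilates (g \+ h).
Proof.
move=> [bg g0] [bh h0]; split; first exact: bounded_measurableD.
move=> phi Pphi; under eq_Rintegral do rewrite mulrDr.
by rewrite RintegralD ?g0 ?h0 ?addr0//; exact: integrable_bounded_mul.
Qed.

Lemma annihilatesZ c h : annihilates h -> annihilates (fun x => c * h x).
Proof.
move=> [bh h0]; split; first exact: bounded_measurableZ.
move=> phi Pphi; under eq_Rintegral do rewrite mulrCA.
by rewrite RintegralZl ?h0 ?mulr0//; exact: integrable_bounded_mul.
Qed.

Lemma annihilates_lim (h_ : nat -> T -> R) (h : T -> R) (M : R) :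
    (forall n, annihilates (h_ n)) -> (forall n x, `|h_ n x| <= M) ->
    (forall x, h_ ^~ x @ \oo --> h x) ->
  annihilates h.
Proof.
move=> h0 hM hh; split; first split.
- by apply: (@measurable_fun_cvg _ _ _ _ h_) => // n; have [[]] := h0 n.
- exists M => x.
  have hx : `|h_ n x| @[n --> \oo] --> `|h x| by apply: cvg_norm; exact: hh.
  rewrite -(cvg_lim _ hx)//; apply: limr_le; last by apply: nearW => n.
  by apply/cvg_ex; exists `|h x|.
- move=> phi Pphi.
  apply: (@Rdominated_eq0 (fun n x => f x * phi x * h_ n x) _
    (fun x => M * `|f x * phi x|)).
  + move=> n; apply/measurable_EFinP; apply: measurable_int.
    by apply: integrable_bounded_mul => //; have [] := h0 n.
  + by move=> x; apply: cvgM => //; exact: cvg_cst.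
  + apply: (@integrableZl _ _ _ mu setT measurableT M
       (EFin \o (fun x => `|f x * phi x|))).
    exact: (integrable_norm (fPhi Pphi)).
  + by move=> n x; rewrite normrM mulrC ler_wpM2r.
  + by move=> n; have [_ ->] := h0 n.
Qed.

(** Complements and finite unions are linear combinations of products of
    indicators; countable unions follow by dominated convergence. Having a
    sigma-algebra at once replaces a monotone class argument. *)
Lemma cut_stable_sigma_algebra : sigma_algebra setT cut_stable.
Proof.
have cut_stableC A : cut_stable A -> cut_stable (~` A).
  move=> [mA cA]; split; first exact: measurableC.
  move=> h h0; have := annihilatesD h0 (annihilatesZ (-1) (cA _ h0)).
  congr annihilates; apply/funext => x /=.
  by rewrite !indicE in_setC; case: (_ \in _) => /=; ring.
have cut_stableI A B : cut_stable A -> cut_stable B -> cut_stable (A `&` B).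
  move=> [mA cA] [mB cB]; split; first exact: measurableI.
  move=> h /cA/cB; congr annihilates; apply/funext => x /=.
  by rewrite indicI/= mulrA.
have cut_stable0 : cut_stable set0.
  split => // h h0; have := annihilatesZ 0 h0.
  by congr annihilates; apply/funext => x /=; rewrite indic0 mul0r mulr0.
have cut_stableU A B : cut_stable A -> cut_stable B -> cut_stable (A `|` B).
  move=> cA cB; rewrite -[_ `|` _]setCK setCU; apply: (cut_stableC).
  by apply: cut_stableI; exact: cut_stableC.
split => //; first by move=> A cA; rewrite setTD; exact: cut_stableC.
move=> A cA; split; first by apply: bigcup_measurable => k _; have [] := cA k.
move=> h h0; have [M hM] := h0.1.2.
pose B n := \big[setU/set0]_(k < n) A k.
have cB n : cut_stable (B n) by rewrite /B; elim/big_ind : _.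
apply: (@annihilates_lim (fun n => h \* \1_(B n)) _ M).
- by move=> n; exact: (cB n).2.
- move=> n x /=; rewrite indicE; case: (_ \in _); rewrite ?mulr1// mulr0 normr0.
  by rewrite (le_trans _ (hM x)).
- move=> x /=; apply: cvgM; first exact: cvg_cst.
  rewrite !indicE; have [[k _ Akx]|nAx] := pselect ((\bigcup_k A k) x).
    rewrite mem_set; last by exists k.
    apply: cvg_near_cst; exists k.+1 => // n /= kn.
    by rewrite indicE mem_set// /B -bigcup_mkord; exists k.
  rewrite memNset//; apply: cvg_near_cst; apply: nearW => n /=.
  rewrite indicE memNset// /B -bigcup_mkord => -[k _ Akx].
  by apply: nAx; exists k.
Qed.

(** How a set gets in: its indicator is a bounded limit of functions by which the
    weights can be multiplied. *)
Lemma cut_stable_lim (psi : nat -> T -> R) (M : R) A : measurable A ->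
    (forall n, bounded_measurable (psi n)) ->
    (forall n x, `|psi n x| <= M) ->
    (forall h n, annihilates h -> annihilates (h \* psi n)) ->
    (forall x, psi ^~ x @ \oo --> (\1_A x : R)) ->
  cut_stable A.
Proof.
move=> mA bpsi psiM apsi psiA; split => // h h0; have [N hN] := h0.1.2.
apply: (@annihilates_lim (fun n => h \* psi n) _ (N * M)).
- by move=> n; exact: apsi.
- by move=> n x /=; rewrite normrM ler_pM.
- by move=> x /=; apply: cvgM; [exact: cvg_cst|exact: psiA].
Qed.

(** Cutting by the sets where [f] is positive and where it is negative makes the
    integrand of constant sign, hence null. *)
Lemma cut_stable_ae_eq0 phi : annihilates (cst 1) ->
  cut_stable [set x | 0 < f x] -> cut_stable [set x | f x < 0] ->
  Phi phi -> (forall x, 0 <= phi x) ->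
  {ae mu, forall x, f x * phi x = 0}.
Proof.
move=> a1 cpos cneg Pphi phi0.
have key (A : set T) (s : R) : cut_stable A ->
    (forall x, 0 <= s * (f x * phi x * (\1_A x : R))) ->
    {ae mu, forall x, s * (f x * phi x * (\1_A x : R)) = 0}.
  move=> cA s0.
  have [b1 /(_ _ Pphi) I0] := annihilatesZ s (cA.2 _ a1).
  have iI := integrable_bounded_mul Pphi b1.
  have : (\int[mu]_x `|(f x * phi x * (s * (1 * \1_A x)))%:E| = 0)%E.
    under eq_integral => x _.
      rewrite gee0_abs; last by have := s0 x; rewrite lee_fin /=; lra.
      over.
    exact: integral_EFin_eq0.
  move/ae_eq_integral_abs => /(_ measurableT) /=.
  move/(_ (measurable_int _ iI)); apply: filterS => x /= E.
  by case: (E Logic.I) => <-; ring.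
have pos : {ae mu, forall x, 1 * (f x * phi x * (\1_[set x | 0 < f x] x : R)) = 0}.
  apply: key => // x; rewrite indicE; case: (boolP (x \in _)) => [/set_mem /= fx|_].
    by rewrite mul1r mulr1 mulr_ge0// ltW.
  by rewrite !mulr0.
have neg : {ae mu, forall x, -1 * (f x * phi x * (\1_[set x | f x < 0] x : R)) = 0}.
  apply: key => // x; rewrite indicE; case: (boolP (x \in _)) => [/set_mem /= fx|_].
    by rewrite mulr1 mulN1r oppr_ge0 mulr_le0_ge0// ltW.
  by rewrite !mulr0.
apply: filterS2 pos neg => x.
rewrite mul1r mulN1r !indicE; have [fx|fx|<-] := ltgtP 0 (f x).
- by rewrite mem_set ?mulr1.
- move=> _; rewrite (@mem_set _ [set x | f x < 0])// mulr1 => /eqP.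
  by rewrite oppr_eq0 => /eqP.
- by rewrite mul0r.
Qed.

End Annihilator.

(** * A smooth function vanishing on a half-line *)

Section SmoothStep.
Context {R : realType}.
Implicit Types (p : {poly R}) (x : R).

(** The family of all p(1/x) exp(-1/x) extended by 0 is closed under
    differentiation, so one first-order computation gives smoothness. *)
Definition flat p x : R := if 0 < x then p.[x^-1] * expR (- x^-1) else 0.

Definition dflat p : {poly R} := 'X^2 * (p - p^`()).

(** A factor y^i is absorbed by the term y^i / i! of the exponential series. *)
Lemma poly_expR_bounded p : exists C : R, 0 <= C /\
  forall y : R, 0 <= y -> `|p.[y] * expR (- y)| <= C.
Proof.
(* From y^i <= i! exp(y) on each monomial. *)
exists (\sum_(i < size p) `|p`_i| * i`!%:R); split.
  by apply: sumr_ge0 => i _; rewrite mulr_ge0.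
move=> y y0; rewrite horner_coef mulr_suml.
rewrite (le_trans (ler_norm_sum _ _ _))// ler_sum// => i _.
rewrite !normrM -mulrA ler_wpM2l// [X in X * _]ger0_norm ?exprn_ge0//.
rewrite ger0_norm ?expR_ge0// expRN ler_pdivrMr ?expR_gt0//.
case: (nat_of_ord i) => [|n].
  by rewrite expr0 fact0 mul1r -expR0 ler_expR.
rewrite mulrC -ler_pdivrMr ?ltr0n ?fact_gt0//.
by rewrite (le_trans _ (expR_ge1Dxn n y0))// lerDr.
Qed.

(** At the origin the difference quotient is at most C |h|, because 1/h^2 times
    the function is bounded. *)
Lemma is_derive_flat p x : is_derive x 1 (flat p) (flat (dflat p) x).
Proof.
have [x0|x0|->] := ltgtP x 0.
- apply: (@near_eq_is_derive _ _ _ (cst 0)) => //.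
    near=> y; rewrite /flat ifF//; apply/negbTE; rewrite -leNgt ltW//.
    by near: y; exact: lt_nbhsl.
  rewrite /flat ltNge (ltW x0)/=; exact: is_derive_cst.
- apply: (@near_eq_is_derive _ _ _ (fun y : R => p.[y^-1] * expR (- y^-1))) => //.
    near=> y; rewrite /flat ifT//.
    by near: y; exact: lt_nbhsr.
  have xn0 : x != 0 by rewrite gt_eqF.
  have dV : is_derive x 1 (fun y : R => y^-1) (- x ^- 2 *: 1).
    exact: (@is_deriveV R id).
  have dp : is_derive x 1 (fun y => p.[y^-1]) (p^`().[x^-1] * (- x ^- 2 *: 1)).
    exact: (@is_derive1_comp _ (horner p) (fun y => y^-1)).
  have dE : is_derive x 1 (fun y => expR (- y^-1))
      (expR (- x^-1) * - (- x ^- 2 *: 1)).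
    exact: (@is_derive1_comp _ expR (fun y => - y^-1)).
  apply: (is_derive_eq (is_deriveM dp dE)).
  rewrite /flat x0 /dflat !hornerE /= /GRing.scale /=.
  by field.
- have [C [C0 hC]] := poly_expR_bounded ('X^2 * p).
  have flat_le (h : R) : `|flat p h| <= C * `|h| ^+ 2.
    rewrite /flat; case: ifPn => h0; last by rewrite normr0 mulr_ge0.
    have hinv : 0 <= h^-1 by rewrite invr_ge0 ltW.
    have {hC} := hC _ hinv; rewrite hornerM hornerXn -mulrA normrM normrX normfV.
    by rewrite exprVn ler_pdivrMl ?exprn_gt0 ?normr_gt0 ?gt_eqF// (mulrC C).
  have flat0 (q : {poly R}) : flat q 0 = 0 by rewrite /flat ltxx.
  suff cv : h^-1 *: ((flat p \o shift 0) (h *: 1) - flat p 0) @[h --> 0^'] --> (0 : R).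
    rewrite flat0; split; first by apply/cvg_ex; exists 0.
    exact: cvg_lim cv.
  apply/cvgr0Pnorm_lt => e e0; near=> h.
  rewrite /= flat0 subr0 addr0 /GRing.scale /= mulr1 normrM normfV.
  have h0 : 0 < `|h| by rewrite normr_gt0; near: h; exact: nbhs_dnbhs_neq.
  rewrite ltr_pdivrMl// (le_lt_trans (flat_le h))//.
  rewrite expr2 mulrCA ltr_pM2l// (@le_lt_trans _ _ ((C + 1) * `|h|))//.
    by rewrite ler_wpM2r// lerDl.
  rewrite -ltr_pdivlMl ?ltr_wpDl// mulrC.
  by near: h; apply: dnbhs0_lt; rewrite divr_gt0// ltr_wpDl.
Unshelve. all: by end_near. Qed.

End SmoothStep.

(** * Functions of class C^k on R^3 *)

Section SmoothFunctions.
Context {R : realType}.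
Implicit Types (x v : R3 R) (i j : 'I_3).

Lemma coord_linear i (h : R) v x :
  coord i (h *: v + x) = h * coord i v + coord i x.
Proof.
rewrite /coord !(tnth_nth 0).
by case: i => [[|[|[|]]]] //= _; rewrite /GRing.scale.
Qed.

Lemma coord_basis i j : coord i (basis3 j : R3 R) = (i == j)%:R.
Proof.
rewrite /coord /basis3 !(tnth_nth 0) -val_eqE/=.
by case: i => [[|[|[|]]]] //= _; rewrite eq_sym.
Qed.

Lemma continuous_coord i : continuous (coord i : R3 R -> R).
Proof.
move=> x; case: i => [[|[|[|]]]] //= hi.
- rewrite (_ : coord _ = fst \o fst).
    by apply: (@continuous_comp _ _ _ fst fst); exact: cvg_fst.
  by apply/funext => y; rewrite /coord (tnth_nth 0).
- rewrite (_ : coord _ = snd \o fst).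
    by apply: (@continuous_comp _ _ _ fst snd); [exact: cvg_fst|exact: cvg_snd].
  by apply/funext => y; rewrite /coord (tnth_nth 0).
- rewrite (_ : coord _ = snd); first exact: cvg_snd.
  by apply/funext => y; rewrite /coord (tnth_nth 0).
Qed.

Lemma is_derive_direction (g : R -> R) (dg w y : R) :
  is_derive y 1 g dg -> is_derive y w g (w * dg).
Proof.
move=> [dgy gE]; have diffg : differentiable g y by exact/derivable1_diffP.
split; first exact: diff_derivable.
by rewrite deriveE// (deriv1E dgy) derive1E gE.
Qed.

(** The difference quotients along [v] of a function of an affine form are
    literally those of a function of one variable. *)
Lemma is_derive_comp_affine (g : R -> R) (dg w : R) (L : R3 R -> R) x v :
    (forall h, L (h *: v + x) = h * w + L x) ->
    is_derive (L x) 1 g dg -> is_derive x v (g \o L) (w * dg).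
Proof.
move=> Lh /(is_derive_direction w)[dw wE].
have E : (fun h : R => h^-1 *: (((g \o L) \o shift x) (h *: v) - (g \o L) x)) =
         (fun h : R => h^-1 *: ((g \o shift (L x)) (h *: w) - g (L x))).
  by apply/funext => h /=; rewrite Lh.
by split; rewrite /derivable /derive E.
Qed.

Lemma is_derive_scale_direction (f : R3 R -> R) (c : R) x v :
  derivable f x v -> is_derive x (c *: v) f (c * 'D_v f x).
Proof.
move=> df; pose G h := f (h *: v + x).
have dG : is_derive (0 : R) 1 G ('D_v f x).
  split; first by move/derivable1P : df.
  rewrite /derive; set g1 := fun h => h^-1 *: _; set g2 := fun h => h^-1 *: _.
  suff -> : g1 = g2 by [].
  by apply/funext => h; rewrite /g1 /g2 /G /= addr0 scale0r add0r [_%:A]mulr1.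
have [dw wE] := is_derive_direction c dG.
have E : (fun h : R => h^-1 *: ((f \o shift x) (h *: (c *: v)) - f x)) =
         (fun h : R => h^-1 *: ((G \o shift 0) (h *: c) - G 0)).
  by apply/funext => h /=; rewrite /G addr0 scale0r add0r scalerA.
by split; rewrite /derivable /derive E.
Qed.

Lemma CkS k (f : R3 R -> R) : Ck k.+1 f -> Ck k f.
Proof.
elim: k f => [|k IH] f [cf H]; first by split.
by split => // i; have [df /IH] := H i; split.
Qed.

Lemma Ck_cst k (c : R) : Ck k (cst c : R3 R -> R).
Proof.
elim: k c => [|k IH] c; split; try exact: cst_continuous; first by [].
move=> i; split => [x|]; first exact: derivable_cst.
rewrite (_ : partial i _ = cst 0)//.
by apply/funext => x; exact: derive_cst.
Qed.

Lemma CkD k (f g : R3 R -> R) : Ck k f -> Ck k g -> Ck k (f \+ g).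
Proof.
elim: k f g => [|k IH] f g [cf Hf] [cg Hg].
  by split => // x; apply: continuousD; [exact: cf|exact: cg].
split => [x|i]; first by apply: continuousD; [exact: cf|exact: cg].
have [[df Cf] [dg Cg]] := (Hf i, Hg i).
split => [x|]; first by apply: derivableD.
rewrite (_ : partial i _ = partial i f \+ partial i g); first exact: IH.
by apply/funext => x; exact: deriveD.
Qed.

Lemma CkM k (f g : R3 R -> R) : Ck k f -> Ck k g -> Ck k (f \* g).
Proof.
elim: k f g => [|k IH] f g Cf Cg.
  split => // x; apply: continuousM; [exact: Cf.1|exact: Cg.1].
split => [x|i]; first by apply: continuousM; [exact: Cf.1|exact: Cg.1].
have [[df Cdf] [dg Cdg]] := (Cf.2 i, Cg.2 i).
split => [x|]; first by apply: derivableM.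
rewrite (_ : partial i _ = f \* partial i g \+ g \* partial i f).
  by apply: CkD; apply: IH => //; exact: CkS.
by apply/funext => x; exact: deriveM.
Qed.

(** The induction is on [k] for all polynomials at once: a partial derivative
    stays in the family. *)
Lemma Ck_flat k (p : {poly R}) (a b : R) i :
  Ck k (fun x => flat p (a * coord i x + b)).
Proof.
have cont q : continuous (fun x => flat q (a * coord i x + b)).
  move=> x; apply: (@continuous_comp _ _ _ (fun x => a * coord i x + b) (flat q)).
    apply: continuousD; last exact: cst_continuous.
    by apply: continuousM; [exact: cst_continuous|exact: continuous_coord].
  apply: differentiable_continuous; apply/derivable1_diffP.
  by have [] := is_derive_flat q (a * coord i x + b).
elim: k p => [|k IH] p; split => // j.
have D x : is_derive x (basis3 j) (fun x => flat p (a * coord i x + b))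
    ((a * (i == j)%:R) * flat (dflat p) (a * coord i x + b)).
  apply: (@is_derive_comp_affine (flat p) _ _ (fun x => a * coord i x + b)).
    by move=> h; rewrite coord_linear coord_basis; ring.
  exact: is_derive_flat.
split => [x|]; first by have [] := D x.
rewrite (_ : partial j _ = cst (a * (i == j)%:R) \*
  (fun x => flat (dflat p) (a * coord i x + b))); first exact/CkM/IH/Ck_cst.
by apply/funext => x; have [] := D x.
Qed.

Lemma reflect3_linear (h : R) v x :
  reflect3 (h *: v + x) = h *: reflect3 v + reflect3 x.
Proof. by rewrite /reflect3 /=; congr pair; rewrite /= opprD scalerN. Qed.

(** The diagonal entries of J. *)
Definition refl_sign i : R := if i == 2%N :> nat then -1 else 1.

Lemma reflect3_basis i : reflect3 (basis3 i) = refl_sign i *: basis3 i :> R3 R.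
Proof.
rewrite /reflect3 /basis3 /refl_sign /=.
case: i => [[|[|[|]]]] //= _; rewrite ?scale1r ?oppr0// scaleN1r.
by rewrite (_ : - (0, 0, 1) = (- 0, - 0, - 1) :> R3 R)// oppr0.
Qed.

Lemma continuous_reflect3 : continuous (@reflect3 R).
Proof.
move=> x; rewrite /reflect3.
have c1 : fst @ nbhs x --> nbhs x.1 by exact: cvg_fst.
have c2 : (fun y : R3 R => - y.2) @ nbhs x --> nbhs (- x.2).
  by apply: cvgN; exact: cvg_snd.
exact: (cvg_pair c1 c2).
Qed.

Lemma is_derive_reflect (f : R3 R -> R) i x :
  derivable f (reflect3 x) (basis3 i) ->
  is_derive x (basis3 i) (f \o reflect3) (refl_sign i * partial i f (reflect3 x)).
Proof.
move=> df; rewrite /partial.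
have E : (fun h : R => h^-1 *: (((f \o reflect3) \o shift x) (h *: basis3 i) -
           (f \o reflect3) x)) =
         (fun h : R => h^-1 *: ((f \o shift (reflect3 x))
           (h *: (refl_sign i *: basis3 i)) - f (reflect3 x))).
  by apply/funext => h /=; rewrite reflect3_linear reflect3_basis.
have [dw wE] := is_derive_scale_direction (refl_sign i) df.
by split; rewrite /derivable /derive E.
Qed.

Lemma Ck_reflect k (f : R3 R -> R) : Ck k f -> Ck k (f \o reflect3).
Proof.
have cont (g : R3 R -> R) : continuous g -> continuous (g \o reflect3).
  by move=> cg x; apply: continuous_comp; [exact: continuous_reflect3|exact: cg].
elim: k f => [|k IH] f [cf H]; split; try exact: cont; first by [].
move=> i; have [df Cf] := H i.
split => [x|]; first by have [] := is_derive_reflect (df (reflect3 x)).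
rewrite (_ : partial i _ = cst (refl_sign i) \* (partial i f \o reflect3)).
  by apply: CkM; [exact: Ck_cst|exact: IH].
by apply/funext => x; have [] := is_derive_reflect (df (reflect3 x)).
Qed.

End SmoothFunctions.

(** * Measurability and square integrability *)

Section MeasurableR3.
Context {R : realType}.

(** The sigma-algebra on R^3 is a product of Borel sigma-algebras; it contains
    the open sets because an open set is the union of the cubes with rational
    centre and radius 1/(n+1) that it contains. *)
Lemma open_measurable3 (O : set (R3 R)) : open O -> measurable O.
Proof.
move=> oO.
pose bx (q : rat * rat * rat * nat) : set (R3 R) :=
  ball (ratr q.1.1.1 : R) (q.2.+1%:R^-1) `*` ball (ratr q.1.1.2 : R) (q.2.+1%:R^-1)
  `*` ball (ratr q.1.2 : R) (q.2.+1%:R^-1).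
pose F q := if pselect (bx q `<=` O) then bx q else set0.
have -> : O = \bigcup_q F q.
  apply/seteqP; split => [x Ox|x [q _]]; last first.
    by rewrite /F; case: pselect => // bO bx'; exact: (bO _ bx').
  have [e /= e0 xeO] : exists2 e : R, 0 < e & ball x e `<=` O.
    by have /nbhs_ballP[e e0 H] := open_nbhs_nbhs (conj oO Ox); exists e.
  have [n _ /(_ _ (leqnn n)) /= ne] :=
    near_infty_natSinv_lt (PosNum (divr_gt0 e0 (ltr0n R 2))).
  have rat_near (t : R) : exists q : rat, ball (ratr q : R) (n.+1%:R^-1) t.
    have tt : t - n.+1%:R^-1 < t + n.+1%:R^-1 by rewrite ltrBlDr -addrA ltrDl addr_gt0.
    have [q] := rat_in_itvoo tt; rewrite in_itv/= => /andP[q1 q2]; exists q.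
    rewrite /ball /= ltr_norml; move: (ratr q : R) (n.+1%:R^-1 : R) q1 q2 => a b.
    by move=> *; apply/andP; split; lra.
  have [[q1 h1] [[q2 h2] [q3 h3]]] := (rat_near x.1.1, (rat_near x.1.2, rat_near x.2)).
  exists (q1, q2, q3, n) => //; rewrite /F; case: pselect => // -[].
  apply: (subset_trans _ xeO) => -[[y1 y2] y3] [[/= g1 g2] g3].
  move: h1 h2 h3 g1 g2 g3; rewrite /ball /= /prod_ball /= => h1 h2 h3 g1 g2 g3.
  have near2 (a b c r : R) : r < e / 2 -> `|a - b| < r -> `|a - c| < r -> `|b - c| < e.
    move=> re; rewrite !ltr_norml => /andP[? ?] /andP[? ?]; apply/andP; split; lra.
  split; first by split; [exact: near2 ne h1 g1|exact: near2 ne h2 g2].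
  exact: near2 ne h3 g3.
apply: countable_bigcupT_measurable; first exact: countableP.
move=> q; rewrite /F; case: pselect => bO; last exact: measurable0.
by apply: measurableX; [apply: measurableX|]; exact: measurable_ball.
Qed.

Lemma continuous_measurable3 (f : R3 R -> R) :
  continuous f -> measurable_fun setT f.
Proof.
move=> cf mD; apply: (measurability _ (RGenOInfty.measurableE R)) => //.
move=> _ [_ [x ->] <-]; rewrite setTI; apply: open_measurable3.
have /continuousP := cf; apply; exact: interval_open.
Qed.

Lemma measurable_coord i : measurable_fun setT (coord i : R3 R -> R).
Proof. by apply: continuous_measurable3; exact: continuous_coord. Qed.

Lemma L2_measurable (f : R3 R -> R) : L2 f -> measurable_fun setT f.
Proof. by rewrite /L2 inE => /andP[/[!inE]/= mf _]; exact: mf. Qed.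

Lemma L2B (f g : R3 R -> R) : L2 f -> L2 g -> L2 (f \- g).
Proof.
move=> Lf Lg; have p1 : (1 <= 2%:E :> \bar R)%E by rewrite lee_fin ler1n.
have [_ H] := Lfun_submod_closed leb3 p1.
have -> : f \- g = (-1) *: g + f.
  by apply/funext => x /=; rewrite addrC; congr (_ + _); rewrite -scaleN1r.
exact: H.
Qed.

Lemma L2D (f g : R3 R -> R) : L2 f -> L2 g -> L2 (f \+ g).
Proof.
move=> Lf Lg; have p1 : (1 <= 2%:E :> \bar R)%E by rewrite lee_fin ler1n.
have [_ H] := Lfun_submod_closed leb3 p1.
have -> : f \+ g = 1 *: f + g by apply/funext => x /=; rewrite scale1r.
exact: H.
Qed.

Lemma leb3_setX (A B C : set R) :
  measurable A -> measurable B -> measurable C ->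
  leb3 (A `*` B `*` C) = (lebesgue_measure A * lebesgue_measure B * lebesgue_measure C)%E.
Proof.
move=> mA mB mC.
transitivity ((lebesgue_measure \x lebesgue_measure) (A `*` B) * lebesgue_measure C)%E.
  by apply: product_measure1E => //; exact: measurableX.
by congr (_ * _)%E; exact: product_measure1E.
Qed.

Definition cube (M : R) : set (R3 R) := `[-M, M] `*` `[-M, M] `*` `[-M, M].

Lemma measurable_cube M : measurable (cube M).
Proof. by apply: measurableX; [exact: measurableX|]. Qed.

Lemma cubeP M x : (forall i, `|coord i x| <= M) <-> cube M x.
Proof.
split => [H|[[/=]]].
  have := (H (@Ordinal 3 0 isT), H (@Ordinal 3 1 isT), H (@Ordinal 3 2 isT)).
  rewrite /coord !(tnth_nth 0) /= => -[[h0 h1] h2].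
  by split; first split; rewrite /= in_itv/= -ler_norml.
rewrite !in_itv/= -!ler_norml => h0 h1 h2 i.
by rewrite /coord (tnth_nth 0); case: i => [[|[|[|]]]].
Qed.

Lemma integrable_cube M : leb3.-integrable setT (EFin \o (\1_(cube M) : R3 R -> R)).
Proof.
have mcube := measurable_cube M.
apply/integrableP; split; first by apply/measurable_EFinP; exact: measurable_indic.
under eq_integral => x _ do rewrite /= ger0_norm//.
rewrite integral_indic// setIT.
have fin : (lebesgue_measure (`[(- M)%R, M]%classic : set R) < +oo)%E.
  by rewrite lebesgue_measure_itv /=; case: ifPn => _; rewrite ?ltry.
have mI := measurable_itv `[- M, M].
have -> : leb3 (cube M) = _ := leb3_setX mI mI mI.
have fI : lebesgue_measure (`[(- M)%R, M]%classic : set R) \is a fin_num.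
  by rewrite ge0_fin_numE.
by rewrite ltey_eq !fin_numM.
Qed.

Lemma coord_le_norm i (x : R3 R) : `|coord i x| <= `|x|.
Proof.
rewrite /coord (tnth_nth 0) prod_normE/= prod_normE/= !le_max.
by case: i => [[|[|[|]]]] //= _; rewrite lexx ?orbT.
Qed.

Lemma test_function_bounded (phi : R3 R -> R) : test_function phi ->
  exists C M : R, 0 <= C /\ forall x, `|phi x| <= C * \1_(cube M) x.
Proof.
move=> [Cphi cK]; set K := closure _ in cK.
have cphi : continuous phi := (Cphi 0%N).1.
have [N [_ /(_ (N + 1)) HN]] := compact_bounded cK.
have [C [_ /(_ (C + 1)) HC]] : bounded_set (phi @` K).
  by apply/compact_bounded/continuous_compact => //; exact: continuous_subspaceT.
exists (Num.max 0 (C + 1)), (N + 1); split; first by rewrite le_max lexx.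
move=> x; have [phix|phix] := eqVneq (phi x) 0.
  by rewrite phix normr0 mulr_ge0// le_max lexx.
have Kx : K x by apply: subset_closure.
rewrite indicE mem_set ?mulr1; last first.
  apply/cubeP => i; have := HN _ _ Kx; rewrite ltrDl ltr01 => /(_ isT).
  by apply: le_trans; exact: coord_le_norm.
rewrite le_max; apply/orP; right; apply: HC; first by rewrite ltrDl.
by exists x.
Qed.

End MeasurableR3.

Section SquareIntegrable.
Context d (T : measurableType d) (R : realType) (mu : {measure set T -> \bar R}).

Definition square_integrable (h : T -> R) :=
  measurable_fun setT h /\ mu.-integrable setT (EFin \o (fun x => h x ^+ 2)).

(** From |h| w <= h^2 + w when 0 <= w <= 1. It applies to test functions
    with [w] the indicator of a cube, and to Gaussians and indicators of balls
    with [w] a Gaussian. *)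
Lemma square_integrable_mul (h phi w : T -> R) (C : R) :
    square_integrable h -> measurable_fun setT phi ->
    mu.-integrable setT (EFin \o w) -> (forall x, 0 <= w x <= 1) ->
    (forall x, `|phi x| <= C * w x) ->
  mu.-integrable setT (EFin \o (h \* phi)).
Proof.
move=> [mh ih] mphi iw w01 phiw.
apply: (@le_integrable _ _ _ _ _ measurableT _
  (fun x => `|C|%:E * ((h x ^+ 2)%:E + (w x)%:E))%E).
- by apply/measurable_EFinP; exact: measurable_funM.
- move=> x _; rewrite -EFinD -EFinM /= lee_fin normrM.
  have /andP[w0 w1] := w01 x.
  have hw : `|h x| * w x <= h x ^+ 2 + w x.
    rewrite -(real_normK (num_real (h x))).
    have := normr_ge0 (h x); move: (`|h x|) (w x) w0 w1 => a b; nra.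
  rewrite [leRHS]ger0_norm ?mulr_ge0 ?addr_ge0 ?sqr_ge0//.
  apply: (@le_trans _ _ (`|C| * (`|h x| * w x))).
    by rewrite mulrCA ler_wpM2l// (le_trans (phiw x))// ler_wpM2r// ler_norm.
  by rewrite ler_wpM2l.
- by apply: integrableZl => //; apply: integrableD.
Qed.

Lemma square_integrableB (f g : T -> R) : square_integrable f -> square_integrable g ->
  square_integrable (f \- g).
Proof.
move=> [mf f2] [mg g2]; split; first exact: measurable_funB.
apply: (@le_integrable _ _ _ _ _ measurableT _
  (fun x => 2%:E * ((f x ^+ 2)%:E + (g x ^+ 2)%:E))%E).
- by apply/measurable_EFinP; apply: measurable_funX; exact: measurable_funB.
- move=> x _; rewrite -EFinD -EFinM /= lee_fin.
  rewrite [leLHS]ger0_norm ?sqr_ge0// [leRHS]ger0_norm; last first.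
    by rewrite mulr_ge0// addr_ge0// sqr_ge0.
  by have := sqr_ge0 (f x + g x); nra.
- by apply: integrableZl => //; apply: integrableD.
Qed.

End SquareIntegrable.

(** * Test functions *)

Section Step.
Context {R : realType}.

Definition step (x : R) : R := flat 1 x.

Lemma step_ge0 x : 0 <= step x.
Proof.
by rewrite /step /flat; case: ifP => // _; rewrite hornerC mul1r expR_ge0.
Qed.

Lemma step_le1 x : step x <= 1.
Proof.
rewrite /step /flat; case: ifP => // x0; rewrite hornerC mul1r -expR0 ler_expR.
by rewrite oppr_le0 invr_ge0 ltW.
Qed.

Lemma step_gt0 x : (0 < step x) = (0 < x).
Proof.
by rewrite /step /flat; case: ifP => // _; rewrite ?ltxx// hornerC mul1r expR_gt0.
Qed.

(** Since step(n x) = exp(-1/(n x)) for x > 0, dilating turns the smooth step into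
    the indicator of the half-line. *)
Lemma step_dilation_cvg (x : R) :
  step (n.+1%:R * x) @[n --> \oo] --> ((0 < x)%R%:R : R).
Proof.
have [x0|x0] := ltP 0 x; last first.
  apply: cvg_near_cst; apply: nearW => n; rewrite /step /flat ifF//.
  by apply/negbTE; rewrite -leNgt mulr_ge0_le0.
rewrite (_ : (fun n => _) = fun n => expR (- (x^-1 * n.+1%:R^-1))); last first.
  apply/funext => n; rewrite /step /flat mulr_gt0// hornerC mul1r invfM mulrC.
  by rewrite mulrC.
have c0 : - (x^-1 * n.+1%:R^-1) @[n --> \oo] --> (0 : R).
  rewrite -[X in _ --> X]oppr0; apply: cvgN; rewrite -[X in _ --> X](mulr0 x^-1).
  by apply: cvgMr; exact: cvg_harmonic.
rewrite (_ : true%:R = expR 0); last by rewrite expR0.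
exact: (cvg_comp _ _ c0 (@continuous_expR R 0)).
Qed.

End Step.

Section TestFunctions.
Context {R : realType}.
Implicit Types (phi : R3 R -> R) (x : R3 R).

Lemma compact_cube (M : R) : compact (cube M).
Proof. by apply: compact_setX; [apply: compact_setX|]; exact: segment_compact. Qed.

Lemma hausdorff3 : hausdorff_space (R3 R).
Proof. exact: norm_hausdorff. Qed.

Lemma compact_closure_sub (A K : set (R3 R)) :
  compact K -> A `<=` K -> compact (closure A).
Proof.
move=> cK AK; apply: (subclosed_compact (@closed_closure _ A) cK).
have /closure_id -> : closed K by apply: compact_closed => //; exact: hausdorff3.
exact: closureS.
Qed.

Lemma test_functionM phi psi : test_function phi -> (forall k, Ck k psi) ->
  test_function (phi \* psi).
Proof.
move=> [Cphi cK] Cpsi; split; first by move=> k; apply: CkM.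
apply: (compact_closure_sub cK) => x /=; rewrite mulf_eq0 => /norP[phix _].
exact: subset_closure.
Qed.

(** A partial derivative vanishes off the closed support, where the function is
    locally zero. *)
Lemma test_function_partial i phi : test_function phi -> test_function (partial i phi).
Proof.
move=> [Cphi cK]; split; first by move=> k; have [_ /(_ i)[]] := Cphi k.+1.
apply: (compact_closure_sub cK) => x /= px; apply: contrapT => nx.
have /closed_openC : closed (closure [set x | phi x != 0]) by exact: closed_closure.
move=> oK; have nK : \near x, phi x = cst 0 x.
  have : nbhs x (~` closure [set x | phi x != 0]) by exact: open_nbhs_nbhs.
  apply: filterS => y /= ny; apply/eqP; apply: contrapT => /negP py.
  by apply: ny; exact: subset_closure.
by move/eqP: px; apply; rewrite /partial (near_eq_derive _ nK) derive_cst.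
Qed.

Lemma reflect3K : involutive (@reflect3 R).
Proof. by move=> [x y]; rewrite /reflect3/= opprK. Qed.

Lemma test_function_reflect phi : test_function phi -> test_function (phi \o reflect3).
Proof.
move=> [Cphi cK]; split; first by move=> k; exact: Ck_reflect.
have cK' : compact (reflect3 @` closure [set x | phi x != 0]).
  apply: continuous_compact => //; apply: continuous_subspaceT.
  exact: continuous_reflect3.
apply: (compact_closure_sub cK') => x /= px; exists (reflect3 x).
  exact: subset_closure.
exact: reflect3K.
Qed.

Lemma partial_reflect i phi x : test_function phi ->
  partial i (phi \o reflect3) x = refl_sign i * partial i phi (reflect3 x).
Proof.
move=> [Cphi _]; have [_ /(_ i)[d _]] := Cphi 1%N.
by have [_ ] := is_derive_reflect (d (reflect3 x)).
Qed.

Definition cutoff1 (M : R) i x := step (1 * coord i x + M) * step (-1 * coord i x + M).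

Definition cutoff M : R3 R -> R :=
  cutoff1 M (@Ordinal 3 0 isT) \* cutoff1 M (@Ordinal 3 1 isT) \*
  cutoff1 M (@Ordinal 3 2 isT).

Lemma cutoff1_gt0 M i x : (0 < cutoff1 M i x) = (`|coord i x| < M).
Proof.
rewrite /cutoff1 mul1r mulN1r.
have [h|h] := boolP (`|coord i x| < M).
  move: h; rewrite ltr_norml => /andP[h1 h2].
  by rewrite mulr_gt0// step_gt0; lra.
apply/negbTE; move: h; rewrite -!leNgt ler_normr => /orP[] h.
  rewrite (_ : step (- coord i x + M) = 0) ?mulr0//.
  by apply/eqP; rewrite eq_le step_ge0 andbT leNgt step_gt0 -leNgt; lra.
rewrite (_ : step (coord i x + M) = 0) ?mul0r//.
by apply/eqP; rewrite eq_le step_ge0 andbT leNgt step_gt0 -leNgt; lra.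
Qed.

Lemma cutoff1_ge0 M i x : 0 <= cutoff1 M i x.
Proof. by rewrite mulr_ge0// step_ge0. Qed.

Lemma cutoff_ge0 M x : 0 <= cutoff M x.
Proof. by rewrite /cutoff /= mulr_ge0 ?cutoff1_ge0// mulr_ge0 ?cutoff1_ge0. Qed.

Lemma cutoff_neq0 M x : (cutoff M x != 0) = [forall i, `|coord i x| < M].
Proof.
apply/idP/forallP => [|h].
  rewrite /cutoff /= mulf_eq0 negb_or mulf_eq0 negb_or -andbA => /and3P[h0 h1 h2] i.
  rewrite -cutoff1_gt0 lt0r cutoff1_ge0 andbT.
  by case: i => [[|[|[|]]]] // hi; rewrite (bool_irrelevance hi isT).
rewrite gt_eqF// /cutoff /=; apply: mulr_gt0; last by rewrite cutoff1_gt0.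
by apply: mulr_gt0; rewrite cutoff1_gt0.
Qed.

Lemma test_function_cutoff M : test_function (cutoff M).
Proof.
split; first by move=> k; apply: CkM; [apply: CkM|]; apply: CkM; exact: Ck_flat.
apply: (compact_closure_sub (@compact_cube M)) => x /=.
by rewrite cutoff_neq0 => /forallP h; apply/cubeP => i; exact: ltW (h i).
Qed.

End TestFunctions.

(** * Uniqueness of weak derivatives *)

Section LevelSets.
Context d (T : measurableType d) (R : realType) (f : T -> R).

Lemma measurable_superlevel a : measurable_fun setT f -> measurable [set x | a < f x].
Proof.
move=> mf; have := mf measurableT _ (measurable_itv `]a, +oo[); rewrite setTI.
by congr measurable; apply/seteqP; split => x /=; rewrite in_itv/= andbT.
Qed.

Lemma measurable_sublevel a : measurable_fun setT f -> measurable [set x | f x < a].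
Proof.
move=> mf; have := mf measurableT _ (measurable_itv `]-oo, a[); rewrite setTI.
by congr measurable; apply/seteqP; split => x /=; rewrite in_itv/=.
Qed.

End LevelSets.

Section SigmaAlgebraR3.
Context {T : pointedType} {R : realType} (G : set (set T)).
Hypothesis sG : sigma_algebra setT G.

Lemma measurable_fun_rays (X : T -> R) : (forall a, G [set x | a < X x]) ->
  measurable_fun setT (X : g_sigma_algebraType G -> R).
Proof.
move=> GX mD; apply: (measurability _ (RGenOInfty.measurableE R)) => //.
move=> _ [_ [a ->] <-]; rewrite setTI; apply: sub_sigma_algebra.
by have := GX a; congr G; apply/seteqP; split => x /=; rewrite in_itv/= andbT.
Qed.

(** Used with the coordinates, and with the coordinates up to the sign of the
    last one: it passes from three functions to all Borel sets of R^3. *)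
Lemma sigma_algebra_preimage3 (X Y Z : T -> R) (A : set (R3 R)) :
  measurable_fun setT (X : g_sigma_algebraType G -> R) ->
  measurable_fun setT (Y : g_sigma_algebraType G -> R) ->
  measurable_fun setT (Z : g_sigma_algebraType G -> R) ->
  measurable A -> G [set x | A (X x, Y x, Z x)].
Proof.
move=> mX mY mZ mA.
have mXYZ := measurable_fun_pair (measurable_fun_pair mX mY) mZ.
have : <<s G >> [set x | A (X x, Y x, Z x)].
  by have := mXYZ measurableT _ mA; rewrite setTI.
by rewrite (sigma_algebra_id sG).
Qed.

End SigmaAlgebraR3.

Section WeakDerivative.
Context {R : realType}.
Implicit Types (f g h : R3 R -> R) (i : 'I_3).

#[global] Instance leb3_ae_filter : Filter (nbhs (almost_everywhere (@leb3 R))).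
Proof. exact: ae_filter_ringOfSetsType. Qed.

Lemma L2_square_integrable f : L2 f -> square_integrable leb3 f.
Proof.
by move=> Lf; split; [exact: L2_measurable|exact: Lfun2_integrable_sqr].
Qed.

Lemma integrable_mul_test f phi : square_integrable leb3 f -> test_function phi ->
  leb3.-integrable setT (EFin \o (f \* phi)).
Proof.
move=> sf tphi; have [C [M [C0 phiM]]] := test_function_bounded tphi.
apply: (square_integrable_mul sf _ (integrable_cube M) _ phiM).
  exact: continuous_measurable3 (tphi.1 0%N).1.
by move=> x; rewrite indicE; case: (_ \in _); rewrite ?ler01 ?lexx.
Qed.

(** The fundamental lemma of the calculus of variations. Multiplying a test
    function by a smooth step in one coordinate gives a test function, so every
    half-space, hence every Borel set, can be cut out. *)
Lemma ae_eq0_test h : square_integrable leb3 h ->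
  (forall phi, test_function phi -> \int[leb3]_x (h x * phi x) = 0) ->
  {ae leb3, forall x, h x = 0}.
Proof.
move=> sh h0.
pose Phi := [set phi : R3 R -> R | test_function phi].
have iPhi phi : Phi phi -> leb3.-integrable setT (EFin \o (h \* phi)).
  exact: integrable_mul_test.
have a1 : annihilates leb3 h Phi (cst 1).
  split; first by split; [exact: measurable_cst|exists 1 => x; rewrite normr1].
  by move=> phi Pphi; under eq_Rintegral do rewrite mulr1; exact: h0.
have sG : sigma_algebra setT (cut_stable leb3 h Phi) by exact: cut_stable_sigma_algebra.
have cray i a : cut_stable leb3 h Phi [set x | a < coord i x].
  pose psi n : R3 R -> R := fun x => step (n.+1%:R * coord i x + - (n.+1%:R * a)).
  have Cpsi n k : Ck k (psi n) by exact: Ck_flat.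
  have bpsi n x : `|psi n x| <= 1 by rewrite ger0_norm ?step_ge0// step_le1.
  have mpsi n : bounded_measurable (psi n).
    by split; [exact: continuous_measurable3 (Cpsi n 0%N).1|exists 1].
  apply: (@cut_stable_lim _ _ R leb3 h Phi iPhi psi 1 [set x | a < coord i x]) => //.
  - exact: (measurable_superlevel _ (measurable_coord i)).
  - move=> g n [bg g0]; split; first exact: (bounded_measurableM bg (mpsi n)).
    move=> phi Pphi.
    rewrite -[RHS](g0 (phi \* psi n)); last exact: test_functionM.
    by apply: eq_Rintegral => x _ /=; ring.
  - move=> x; rewrite (_ : psi ^~ x = fun n => step (n.+1%:R * (coord i x - a))).
      rewrite indicE (_ : (x \in _) = (0 < coord i x - a)).
        exact: step_dilation_cvg.
      by rewrite subr_gt0; apply/idP/idP => [/set_mem|/mem_set].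
    by apply/funext => n; rewrite /psi mulrBr.
have mG (A : set (R3 R)) : measurable A -> cut_stable leb3 h Phi A.
  move=> mA.
  have := sigma_algebra_preimage3 sG (measurable_fun_rays (cray (@Ordinal 3 0 isT)))
    (measurable_fun_rays (cray (@Ordinal 3 1 isT)))
    (measurable_fun_rays (cray (@Ordinal 3 2 isT))) mA.
  congr cut_stable; apply/funext => -[[x y] z] /=.
  by rewrite /coord !(tnth_nth 0).
have mpos := measurable_superlevel 0 sh.1.
have mneg := measurable_sublevel 0 sh.1.
have : {ae leb3, forall x, forall n : nat, h x * cutoff (n%:R : R) x = 0}.
  apply: ae_foralln => n.
  apply: (@cut_stable_ae_eq0 _ _ R leb3 h Phi iPhi (cutoff n%:R) a1 (mG _ mpos) (mG _ mneg)).
    exact: test_function_cutoff.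
  exact: cutoff_ge0.
apply: filterS => x H.
have := H (Num.truncn `|x|).+1.
move/eqP; rewrite mulf_eq0 => /orP[/eqP//|].
suff /negbTE -> : cutoff (Num.truncn `|x|).+1%:R x != 0 by [].
rewrite cutoff_neq0; apply/forallP => i; apply: (le_lt_trans (coord_le_norm _ _)).
exact: truncnS_gt.
Qed.

Lemma weak_partial_unique i f g h : square_integrable leb3 g ->
  square_integrable leb3 h -> is_weak_partial i f g -> is_weak_partial i f h ->
  {ae leb3, forall x, g x = h x}.
Proof.
move=> sg sh wg wh.
have : {ae leb3, forall x, (g \- h) x = 0}.
  apply: ae_eq0_test; first exact: square_integrableB.
  move=> phi tphi; under eq_Rintegral do rewrite mulrBl.
  rewrite RintegralB//; [|exact: integrable_mul_test..].
  by apply/eqP; rewrite subr_eq0 -eqr_opp -(wg _ tphi) -(wh _ tphi).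
by apply: filterS => x /eqP; rewrite subr_eq0 => /eqP.
Qed.

Lemma weak_partialP i f : (exists g, L2 g /\ is_weak_partial i f g) ->
  L2 (weak_partial i f) /\ is_weak_partial i f (weak_partial i f).
Proof.
by move=> [g Hg]; rewrite /weak_partial; case: xgetP => [k -> //|/(_ g)].
Qed.

Lemma is_weak_partialB i f1 f2 g1 g2 : L2 f1 -> L2 f2 -> L2 g1 -> L2 g2 ->
  is_weak_partial i f1 g1 -> is_weak_partial i f2 g2 ->
  is_weak_partial i (f1 \- f2) (g1 \- g2).
Proof.
move=> Lf1 Lf2 Lg1 Lg2 w1 w2 phi tphi.
have tp := test_function_partial i tphi.
under eq_Rintegral do rewrite mulrBl.
rewrite RintegralB//; try by apply: integrable_mul_test => //; exact: L2_square_integrable.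
under [in RHS]eq_Rintegral do rewrite mulrBl.
rewrite RintegralB//; try by apply: integrable_mul_test => //; exact: L2_square_integrable.
by rewrite w1// w2//; ring.
Qed.

Lemma componentB i (u v : R3 R -> R3 R) :
  component i (u \- v) = component i u \- component i v.
Proof.
apply/funext => x; rewrite /component /coord /= !(tnth_nth 0).
by case: i => [[|[|[|]]]].
Qed.

Lemma sobolevH1_weak_partial (u : R3 R -> R3 R) i : sobolevH1 u ->
  L2 (weak_partial i (component i u)) /\
  is_weak_partial i (component i u) (weak_partial i (component i u)).
Proof. by move=> Hu; apply: weak_partialP; have [_] := Hu i. Qed.

(** The weak partial derivatives of a difference are selected independently of
    those of the two terms; uniqueness relates them. *)
Lemma weak_divB (u v : R3 R -> R3 R) : sobolevH1 u -> sobolevH1 v ->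
  {ae leb3, forall x, weak_div (u \- v) x = weak_div u x - weak_div v x}.
Proof.
move=> Hu Hv.
have : {ae leb3, forall x, forall i : 'I_3, weak_partial i (component i (u \- v)) x =
    weak_partial i (component i u) x - weak_partial i (component i v) x}.
  apply: filter_forall => i.
  have [Lgu wgu] := sobolevH1_weak_partial i Hu.
  have [Lgv wgv] := sobolevH1_weak_partial i Hv.
  have Lg := L2B Lgu Lgv.
  have wg : is_weak_partial i (component i (u \- v)) _ :=
    ltac:(rewrite componentB; exact: (is_weak_partialB (Hu i).1 (Hv i).1 Lgu Lgv wgu wgv)).
  have [Lh wh] := @weak_partialP i (component i (u \- v)) (ex_intro _ _ (conj Lg wg)).
  exact: (weak_partial_unique (L2_square_integrable Lh) (L2_square_integrable Lg) wh wg).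
by apply: filterS => x H; rewrite /weak_div -sumrB; apply: eq_bigr => i _; exact: H.
Qed.

Lemma weak_div_L2 (u : R3 R -> R3 R) : sobolevH1 u -> L2 (weak_div u).
Proof.
move=> Hu; pose g i := weak_partial i (component i u).
have Lg i : L2 (g i) by have [] := sobolevH1_weak_partial i Hu.
rewrite (_ : weak_div u = g ord0 \+ g (lift ord0 ord0) \+ g (lift ord0 (lift ord0 ord0))).
  by apply: L2D => //; apply: L2D.
have sum3 (F : 'I_3 -> R) : \sum_(i < 3) F i =
    F ord0 + F (lift ord0 ord0) + F (lift ord0 (lift ord0 ord0)).
  by rewrite !big_ord_recl big_ord0 addr0 addrA.
by apply/funext => x; exact: (sum3 (fun i => g i x)).
Qed.

End WeakDerivative.

(** * Evenness of the weak divergence *)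

Section MeasurePreserving.
Context d (T : measurableType d) (R : realType) (mu : {measure set T -> \bar R}).
Context (phi : T -> T).
Hypothesis mphi : measurable_fun setT phi.
Hypothesis phiE : forall A, measurable A -> mu (phi @^-1` A) = mu A.

Lemma integrable_comp_preserving (f : T -> R) :
  mu.-integrable setT (EFin \o f) -> mu.-integrable setT (EFin \o (f \o phi)).
Proof.
move=> /integrableP[mf fi]; apply/integrableP; split.
  exact: (measurableT_comp mf mphi).
apply: le_lt_trans fi; rewrite le_eqVlt; apply/orP; left; apply/eqP.
have mabs : measurable_fun setT (fun y => `|(f y)%:E|)%E by exact: measurableT_comp.
have /= <- := @ge0_integral_pushforward _ _ _ _ R _ mphi mu setT (fun y => `|(f y)%:E|)%E
  measurableT mabs (fun y _ => abse_ge0 _).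
by apply: eq_measure_integral => A mA _; exact: phiE.
Qed.

Lemma Rintegral_comp_preserving (f : T -> R) : mu.-integrable setT (EFin \o f) ->
  \int[mu]_x f (phi x) = \int[mu]_x f x.
Proof.
move=> fi; have [mf _] := integrableP _ _ _ fi; rewrite /Rintegral; congr fine.
have /= <- := @integral_pushforward _ _ _ _ R _ mphi mu setT (EFin \o f) mf
  (integrable_comp_preserving fi) measurableT.
by apply: eq_measure_integral => A mA _; exact: phiE.
Qed.

End MeasurePreserving.

Section ProductSigmaFinite.
Context d1 d2 (T1 : measurableType d1) (T2 : measurableType d2) (R : realType).
Context (m1 : {sigma_finite_measure set T1 -> \bar R}).
Context (m2 : {sigma_finite_measure set T2 -> \bar R}).

Lemma sigma_finite_product : sigma_finite setT (m1 \x m2)%E.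
Proof.
have /sigma_finiteP[F [TF ndF Foo]] := sigma_finiteT m1.
have /sigma_finiteP[G [TG ndG Goo]] := sigma_finiteT m2.
exists (fun n => F n `*` G n) => [|n].
  apply/esym/seteqP; split => // -[x y] _.
  have [i _ Fix] : (\bigcup_n F n) x by rewrite -TF.
  have [j _ Gjy] : (\bigcup_n G n) y by rewrite -TG.
  exists (maxn i j) => //; split => /=.
    by apply: (subsetPset _ _ (ndF _ _ (leq_maxl i j))).
  by apply: (subsetPset _ _ (ndG _ _ (leq_maxr i j))).
have [mF Fn] := Foo n; have [mG Gn] := Goo n; split; first exact: measurableX.
by rewrite product_measure1E// lte_mul_pinfty// ge0_fin_numE.
Qed.

End ProductSigmaFinite.

(** The planar measure gets its own name, and [vol3] below likewise names the
    function underlying [leb3], so that sigma-finiteness can be attached to them. *)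
Definition leb2 (R : realType) : set (measurableTypeR R * measurableTypeR R) -> \bar R :=
  (@lebesgue_measure R \x @lebesgue_measure R)%E.
HB.instance Definition _ (R : realType) := Measure.on (@leb2 R).
HB.instance Definition _ (R : realType) :=
  Measure_isSigmaFinite.Build _ _ _ (@leb2 R)
    (sigma_finite_product (@lebesgue_measure R) (@lebesgue_measure R)).

Definition vol3 (R : realType) :
  set (measurableTypeR R * measurableTypeR R * measurableTypeR R) -> \bar R :=
  (@leb2 R \x @lebesgue_measure R)%E.
HB.instance Definition _ (R : realType) := Measure.on (@vol3 R).
HB.instance Definition _ (R : realType) :=
  Measure_isSigmaFinite.Build _ _ _ (@vol3 R)
    (sigma_finite_product (@leb2 R) (@lebesgue_measure R)).

Section Reflection.
Context {R : realType}.
Implicit Types (f g h : R3 R -> R) (i : 'I_3).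

Lemma measurable_reflect3 : measurable_fun setT (@reflect3 R).
Proof.
apply: measurable_fun_pair; first exact: measurable_fst.
by apply: measurableT_comp; [exact: oppr_measurable|exact: measurable_snd].
Qed.

Lemma leb3_reflect3 (A : set (R3 R)) : measurable A -> leb3 (reflect3 @^-1` A) = leb3 A.
Proof.
move=> mA; have mr := measurable_reflect3.
suff E : (@leb2 R \x @lebesgue_measure R)%E A = pushforward leb3 (@reflect3 R) A.
  exact/esym/E.
pose T3 := (measurableTypeR R * measurableTypeR R * measurableTypeR R)%type.
pose m' : {measure set T3 -> \bar R} := pushforward (@leb3 R) (@reflect3 R : T3 -> T3).
apply: (@product_measure_unique _ _ _ _ R (@leb2 R) (@lebesgue_measure R) (m' mr) _ A mA).
move=> B C mB mC /=; rewrite /pushforward.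
rewrite (_ : _ @^-1` _ = B `*` (-%R @^-1` C)); last by apply/seteqP; split=> -[].
have -> : lebesgue_measure C = lebesgue_measure (-%R @^-1` C).
  exact/esym/lebesgue_measureN.
apply: product_measure1E => //.
by rewrite -[X in measurable X]setTI; exact: oppr_measurable.
Qed.

Lemma Rintegral_reflect3 f : leb3.-integrable setT (EFin \o f) ->
  \int[leb3]_x f (reflect3 x) = \int[leb3]_x f x.
Proof.
exact: (@Rintegral_comp_preserving _ _ R leb3 _ measurable_reflect3 leb3_reflect3 f).
Qed.

Lemma square_integrable_reflect3 f : square_integrable leb3 f ->
  square_integrable leb3 (f \o reflect3).
Proof.
move=> [mf f2]; split; first exact: (measurableT_comp mf measurable_reflect3).
exact: (@integrable_comp_preserving _ _ R leb3 _ measurable_reflect3 leb3_reflect3 _ f2).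
Qed.

(** Both the component and the partial derivative of the reflected test function
    pick up the sign [refl_sign i], and the two signs cancel. *)
Lemma is_weak_partial_reflect i f g : square_integrable leb3 f ->
  square_integrable leb3 g ->
  {ae leb3, forall x, f (reflect3 x) = refl_sign i * f x} -> is_weak_partial i f g ->
  is_weak_partial i f (g \o reflect3).
Proof.
move=> sf sg fs wg phi tphi.
have ss : refl_sign i * refl_sign i = 1 :> R.
  by rewrite /refl_sign; case: ifP; rewrite ?mulrNN mulr1.
have tp := test_function_partial i tphi.
have tpr := test_function_partial i (test_function_reflect tphi).
have mtest psi : test_function psi -> measurable_fun
    [set: measurableTypeR R * measurableTypeR R * measurableTypeR R] psi.
  by move=> tpsi; exact: continuous_measurable3 (tpsi.1 0%N).1.
have iL : leb3.-integrable setT (EFin \o (fun x => f x * partial i (phi \o reflect3) x)).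
  exact: integrable_mul_test.
have iR : leb3.-integrable setT (EFin \o (fun x => g x * (phi \o reflect3) x)).
  by apply: integrable_mul_test => //; exact: test_function_reflect.
(* Replace [f] by its reflection up to sign, so that the whole integrand is a
   reflected one. *)
transitivity (\int[leb3]_x (f (reflect3 x) * partial i (phi \o reflect3) (reflect3 x))).
  apply: (@ae_eq_Rintegral _ _ R leb3).
  - by apply: measurable_funM; [exact: sf.1|exact: mtest].
  - apply: measurable_funM; first exact: (measurableT_comp sf.1 measurable_reflect3).
    exact: (measurableT_comp (mtest _ tpr) measurable_reflect3).
  - apply: filterS fs => x ->.
    by rewrite partial_reflect// reflect3K mulrACA ss mul1r.
rewrite (Rintegral_reflect3 iL) (wg _ (test_function_reflect tphi)).
rewrite -(Rintegral_reflect3 iR); congr (- _).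
by apply: eq_Rintegral => x _ /=; rewrite reflect3K.
Qed.

Lemma weak_div_even (u : R3 R -> R3 R) : sobolevH1e u ->
  {ae leb3, forall x, weak_div u (reflect3 x) = weak_div u x}.
Proof.
move=> [Hu ue].
have : {ae leb3, forall x, forall i : 'I_3,
    weak_partial i (component i u) (reflect3 x) = weak_partial i (component i u) x}.
  apply: filter_forall => i; have [Lg wg] := sobolevH1_weak_partial i Hu.
  have sg := L2_square_integrable Lg.
  apply: (weak_partial_unique (square_integrable_reflect3 sg) sg _ wg).
  apply: is_weak_partial_reflect => //; first exact: L2_square_integrable (Hu i).1.
  apply: filterS ue => x E; rewrite /component E /coord !(tnth_nth 0) /refl_sign.
  by case: i {Lg wg sg} => [[|[|[|]]]] //= _; rewrite ?mul1r ?mulN1r.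
by apply: filterS => x H; rewrite /weak_div; apply: eq_bigr => i _; exact: H.
Qed.

End Reflection.

(** * Gaussians centred on the plane *)

Section IntegrableTensor.
Context d1 d2 (T1 : measurableType d1) (T2 : measurableType d2) (R : realType).
Context (m1 : {sigma_finite_measure set T1 -> \bar R}).
Context (m2 : {sigma_finite_measure set T2 -> \bar R}).

Lemma integrable_tensor (f : T1 -> R) (g : T2 -> R) :
  m1.-integrable setT (EFin \o f) -> m2.-integrable setT (EFin \o g) ->
  (m1 \x m2)%E.-integrable setT (EFin \o (fun z => f z.1 * g z.2)).
Proof.
move=> fi gi; have [mf fy] := integrableP _ _ _ fi; have [mg gy] := integrableP _ _ _ gi.
have mf' : measurable_fun setT f by exact/measurable_EFinP.
have mg' : measurable_fun setT g by exact/measurable_EFinP.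
have mnf : measurable_fun setT (fun x => `|f x|%:E).
  by apply/measurable_EFinP; exact: measurableT_comp.
have mng : measurable_fun setT (fun x => `|g x|%:E).
  by apply/measurable_EFinP; exact: measurableT_comp.
apply/integrable12ltyP.
  apply/measurable_EFinP; apply: measurable_funM.
    exact: (measurableT_comp mf' measurable_fst).
  exact: (measurableT_comp mg' measurable_snd).
rewrite (eq_integral (fun x => `|f x|%:E * \int[m2]_y `|g y|%:E)%E); last first.
  move=> x _; rewrite -ge0_integralZl//.
  by apply: eq_integral => y _; rewrite /= normrM EFinM.
have g0 : (0 <= \int[m2]_y `|g y|%:E)%E by exact: integral_ge0.
rewrite ge0_integralZr//.
by rewrite lte_mul_pinfty ?ge0_fin_numE//; exact: integral_ge0.
Qed.

End IntegrableTensor.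

Section Gaussian.
Context {R : realType}.
Implicit Types (c : R * R) (y : R3 R) (t s r : R).

(** The squared Euclidean distance from [y] to the point (c, 0) of the plane. *)
Definition sqdist c y : R := (y.1.1 - c.1) ^+ 2 + (y.1.2 - c.2) ^+ 2 + y.2 ^+ 2.

Definition gaussian t c y : R := expR (- (t * sqdist c y)).

Lemma sqdist_ge0 c y : 0 <= sqdist c y.
Proof. by rewrite !addr_ge0 ?sqr_ge0. Qed.

Lemma gaussian_gt0 t c y : 0 < gaussian t c y.
Proof. exact: expR_gt0. Qed.

Lemma gaussian_le1 t c y : 0 <= t -> gaussian t c y <= 1.
Proof.
by move=> t0; rewrite -expR0 ler_expR oppr_le0 mulr_ge0 ?sqdist_ge0.
Qed.

Lemma continuous_sqdist c : continuous (sqdist c).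
Proof.
move=> y.
have c11 : z.1.1 @[z --> y] --> y.1.1.
  by apply: (@continuous_comp _ _ _ fst fst); exact: cvg_fst.
have c12 : z.1.2 @[z --> y] --> y.1.2.
  by apply: (@continuous_comp _ _ _ fst snd); [exact: cvg_fst|exact: cvg_snd].
have c2 : z.2 @[z --> y] --> y.2 by exact: cvg_snd.
rewrite /continuous_at /sqdist; apply: cvgD; first apply: cvgD.
- by rewrite expr2; apply: cvgM; apply: cvgB => //; exact: cvg_cst.
- by rewrite expr2; apply: cvgM; apply: cvgB => //; exact: cvg_cst.
- by rewrite expr2; apply: cvgM.
Qed.

Lemma continuous_gaussian t c : continuous (gaussian t c).
Proof.
move=> y; apply: (@continuous_comp _ _ _ (fun y => - (t * sqdist c y)) expR).
  apply: continuousN; apply: continuousM; first exact: cst_continuous.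
  exact: continuous_sqdist.
exact: continuous_expR.
Qed.

Lemma measurable_gaussian t c : measurable_fun setT (gaussian t c).
Proof. by apply: continuous_measurable3; exact: continuous_gaussian. Qed.

Lemma integrable_gaussian1 t (a : R) : 0 < t ->
  lebesgue_measure.-integrable setT (EFin \o (fun x : R => expR (- (t * (x - a) ^+ 2)))).
Proof.
move=> t0; pose s := Num.sqrt (t *+ 2)^-1.
have s0 : s != 0 by rewrite gt_eqF// sqrtr_gt0 invr_gt0 mulrn_wgt0.
have := integrableZl measurableT (normal_peak s)^-1 (integrable_normal_pdf a s).
apply: eq_integrable => // x _ /=.
rewrite normal_pdfE// -EFinM mulKf; last by rewrite gt_eqF// normal_peak_gt0.
rewrite /normal_fun sqr_sqrtr; last by rewrite invr_ge0 mulrn_wge0// ltW.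
congr (expR _)%:E; rewrite -mulr_natr -[t *+ 2]mulr_natr.
by field; rewrite gt_eqF.
Qed.

Lemma integrable_gaussian t c : 0 < t ->
  leb3.-integrable setT (EFin \o gaussian t c).
Proof.
move=> t0.
have i2 := integrable_tensor (integrable_gaussian1 c.1 t0) (integrable_gaussian1 c.2 t0).
have := @integrable_tensor _ _ _ _ R (@leb2 R) (@lebesgue_measure R) _ _ i2
  (integrable_gaussian1 0 t0).
apply: eq_integrable => // y _ /=; congr EFin.
rewrite /gaussian -!expRD; congr expR; rewrite /sqdist; ring.
Qed.

End Gaussian.

(** * From balls to Gaussians *)

Section Radial.
Context {R : realType}.
Implicit Types (c : R * R) (y : R3 R) (t s r : R).

(** Minus the derivative of exp(-t r^2). *)
Definition radial_density t r : R := 2 * t * r * expR (- (t * r ^+ 2)).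

Lemma is_derive_exp_sqr t r :
  is_derive r 1 (fun x => - expR (- (t * x ^+ 2))) (radial_density t r).
Proof.
have d2 : is_derive r 1 (fun x : R => x * x) (r *: 1 + r *: 1) by exact: is_deriveM.
have dq : is_derive r 1 (fun x : R => - (t * (x * x))) (- (t * (r *: 1 + r *: 1))).
  by apply: is_deriveN; exact: is_deriveZ.
have -> : (fun x => - expR (- (t * x ^+ 2))) = - (expR \o (fun x : R => - (t * (x * x)))).
  by apply/funext => x /=; rewrite expr2.
apply: (is_derive_eq (is_deriveN (is_derive1_comp (is_derive_expR _) dq))).
by rewrite /radial_density /GRing.scale /= expr2; ring.
Qed.

Lemma continuous_radial_density t : continuous (radial_density t).
Proof.
move=> r; rewrite /continuous_at /radial_density; apply: cvgM.
  by apply: cvgM; [exact: cvg_cst|exact: cvg_id].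
apply: (@continuous_comp _ _ _ (fun x : R => - (t * x ^+ 2)) expR).
  by apply: cvgN; apply: cvgM; [exact: cvg_cst|exact: exprn_continuous].
exact: continuous_expR.
Qed.

Lemma cvg_exp_sqr t : 0 < t -> - expR (- (t * x ^+ 2)) @[x --> +oo] --> (0 : R).
Proof.
move=> t0; rewrite -[X in _ --> X]oppr0; apply: cvgN.
apply: (@cvg_comp _ _ _ (fun x : R => t * x ^+ 2) (fun x => expR (- x))).
  by apply: gt0_cvgMry => //; exact: cvgr_expr2.
exact: cvgr_expR.
Qed.

Definition radial_set s : set R := [set r | 0 < r /\ s < r ^+ 2].

Lemma radial_setE s : 0 <= s -> radial_set s = `]Num.sqrt s, +oo[%classic.
Proof.
move=> s0; apply/seteqP; split => r /=; rewrite in_itv/= andbT.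
  move=> [r0 sr]; rewrite -(ger0_norm (ltW r0)) -sqrtr_sqr ltr_sqrt//.
  by rewrite exprn_gt0.
move=> sr; have r0 : 0 < r by exact: le_lt_trans (sqrtr_ge0 s) sr.
by split => //; rewrite -(sqr_sqrtr s0) ltr_pXn2r// ?nnegrE ?sqrtr_ge0// ltW.
Qed.

Lemma measurable_radial t s : 0 <= s ->
  measurable_fun setT (fun r => radial_density t r * \1_(radial_set s) r).
Proof.
move=> s0; apply: measurable_funM.
  by apply: continuous_measurable_fun; exact: continuous_radial_density.
by apply: measurable_indic; rewrite radial_setE.
Qed.

Lemma radial_ge0 t s r : 0 < t -> 0 <= radial_density t r * \1_(radial_set s) r.
Proof.
move=> t0; rewrite indicE; case: (boolP (r \in _)) => [/set_mem[r0 _]|_].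
  by rewrite mulr1 !mulr_ge0 ?expR_ge0// ltW.
by rewrite mulr0.
Qed.

Lemma integral_radial t s : 0 < t -> 0 <= s ->
  (\int[lebesgue_measure]_r (radial_density t r * \1_(radial_set s) r)%:E =
   (expR (- (t * s)))%:E)%E.
Proof.
move=> t0 s0.
transitivity (\int[lebesgue_measure]_(r in `]Num.sqrt s, +oo[) (radial_density t r)%:E)%E.
  rewrite [RHS]integral_mkcond; apply: eq_integral => r _.
  rewrite patchE indicE radial_setE//; case: ifP => _; by rewrite ?mulr1 ?mulr0.
rewrite integral_itv_obnd_cbnd; last first.
  apply/measurable_EFinP; apply: measurable_funTS.
  by apply: continuous_measurable_fun; exact: continuous_radial_density.
rewrite (@ge0_continuous_FTC2y _ _ (fun x => - expR (- (t * x ^+ 2))) _ 0).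
- by rewrite sub0e -EFinN opprK sqr_sqrtr.
- move=> x sx; have x0 : 0 <= x by exact: le_trans (sqrtr_ge0 s) sx.
  by rewrite /radial_density !mulr_ge0 ?expR_ge0// ltW.
- by apply: continuous_subspaceT; exact: continuous_radial_density.
- exact: cvg_exp_sqr.
- by move=> x _; have [] := is_derive_exp_sqr t x.
- apply: cvg_at_right_filter.
  have cF : {for Num.sqrt s, continuous (fun x : R => - expR (- (t * x ^+ 2)))}.
    apply: differentiable_continuous; apply/derivable1_diffP.
    by have [] := is_derive_exp_sqr t (Num.sqrt s).
  exact: cF.
- by move=> x _; rewrite derive1E; have [] := is_derive_exp_sqr t x.
Qed.

Lemma integrable_radial t s : 0 < t -> 0 <= s -> lebesgue_measure.-integrable setT
  (EFin \o (fun r => radial_density t r * \1_(radial_set s) r)).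
Proof.
move=> t0 s0; apply/integrableP; split.
  by apply/measurable_EFinP; exact: measurable_radial.
under eq_integral => r _ do rewrite /= ger0_norm ?radial_ge0//.
by rewrite integral_radial// ltry.
Qed.

Lemma integrable_mul_gaussian (f : R3 R -> R) t c : square_integrable leb3 f -> 0 < t ->
  leb3.-integrable setT (EFin \o (f \* gaussian t c)).
Proof.
move=> sf t0; apply: (@square_integrable_mul _ _ R leb3 f (gaussian t c) (gaussian t c) 1).
- exact: sf.
- exact: measurable_gaussian.
- exact: integrable_gaussian.
- by move=> y; rewrite (ltW (gaussian_gt0 _ _ _)) gaussian_le1// ltW.
- by move=> y; rewrite mul1r ger0_norm// ltW// gaussian_gt0.
Qed.

Lemma eballE c r : 0 < r -> eball (c, 0) r = [set y | sqdist c y < r ^+ 2].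
Proof.
move=> r0; apply/seteqP; split => y; rewrite /eball /enorm /=;
  rewrite (_ : \sum_(i < 3) _ = sqdist c y).
- by rewrite -{1}(ger0_norm (ltW r0)) -sqrtr_sqr ltr_sqrt// exprn_gt0.
- by rewrite !big_ord_recl big_ord0 /coord !(tnth_nth 0) /= subr0 addr0 addrA.
- by rewrite -{2}(ger0_norm (ltW r0)) -sqrtr_sqr ltr_sqrt// exprn_gt0.
- by rewrite !big_ord_recl big_ord0 /coord !(tnth_nth 0) /= subr0 addr0 addrA.
Qed.

Lemma measurable_sqdist c : measurable_fun setT (sqdist c).
Proof. by apply: continuous_measurable3; exact: continuous_sqdist. Qed.

Lemma measurable_eball c r : 0 < r -> measurable (eball (c, 0) r : set (R3 R)).
Proof. by move=> r0; rewrite eballE//; exact: measurable_sublevel (measurable_sqdist c). Qed.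

Lemma integrable_eball (f : R3 R -> R) c r : square_integrable leb3 f -> 0 < r ->
  leb3.-integrable setT (EFin \o (f \* \1_(eball (c, 0) r))).
Proof.
move=> sf r0; pose M := expR (r ^+ 2).
apply: (@square_integrable_mul _ _ R leb3 f _ (gaussian 1 c) M) => //.
- by apply: measurable_indic; exact: measurable_eball.
- exact: integrable_gaussian.
- by move=> y; rewrite (ltW (gaussian_gt0 _ _ _)) gaussian_le1.
- move=> y; rewrite indicE; case: (boolP (y \in _)) => [|_].
    rewrite eballE// => /set_mem /= yr; rewrite normr1 /M /gaussian -expRD -[leLHS]expR0.
    by rewrite ler_expR mul1r subr_ge0 ltW.
  by rewrite normr0 mulr_ge0// ltW ?expR_gt0 ?gaussian_gt0.
Qed.

#[global] Instance lebesgue_ae_filter :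
  Filter (nbhs (almost_everywhere (@lebesgue_measure R))).
Proof. exact: ae_filter_ringOfSetsType. Qed.

(** A Gaussian is a superposition of indicators of balls: exp(-t s) is the integral
    of [radial_density t] over the r > 0 with s < r^2. Exchange the integrals. *)
Lemma gaussian_of_eball (f : R3 R -> R) c t : square_integrable leb3 f -> 0 < t ->
  {ae lebesgue_measure, forall r, 0 < r -> \int[leb3]_(y in eball (c, 0) r) f y = 0} ->
  \int[leb3]_y (f y * gaussian t c y) = 0.
Proof.
move=> sf t0 ball0.
pose mR := measurableTypeR R; pose F (p : mR * mR * mR * mR) : \bar R :=
  (f p.1 * (radial_density t p.2 * \1_(radial_set (sqdist c p.1)) p.2))%:E.
have radial_indic r y : 0 < r ->
    \1_(radial_set (sqdist c y)) r = \1_(eball (c, 0) r) y :> R.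
  move=> r0; rewrite !indicE eballE//; congr (nat_of_bool _)%:R.
  by apply/idP/idP => /set_mem H; apply/mem_set; [exact: H.2|split].
have mF : measurable_fun setT F.
  apply/measurable_EFinP; apply: measurable_funM.
    exact: (measurableT_comp sf.1 measurable_fst).
  apply: measurable_funM.
    apply: (measurableT_comp _ measurable_snd).
    by apply: continuous_measurable_fun; exact: continuous_radial_density.
  pose D := [set p : R3 R * R | 0 < p.2] `&` [set p | 0 < p.2 ^+ 2 - sqdist c p.1].
  have mD : measurable D.
    apply: measurableI; apply: measurable_superlevel; first exact: measurable_snd.
    apply: measurable_funB; first by apply: measurable_funX; exact: measurable_snd.
    exact: (measurableT_comp (measurable_sqdist c) measurable_fst).
  have := @measurable_indic _ _ R setT D mD.
  congr measurable_fun; apply/funext => p.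
  rewrite !indicE; congr (nat_of_bool _)%:R.
  by apply/idP/idP => /set_mem[p0 ps]; apply/mem_set; split => //;
    move: ps; rewrite /= subr_gt0.
have iF : (@vol3 R \x @lebesgue_measure R)%E.-integrable setT F.
  apply/integrable12ltyP => //.
  have [_] := integrableP _ _ _ (integrable_mul_gaussian c sf t0).
  apply: le_lt_trans; rewrite le_eqVlt; apply/orP; left; apply/eqP.
  apply: eq_integral => y _ /=.
  rewrite normrM (ger0_norm (ltW (gaussian_gt0 t c y))) EFinM.
  rewrite /gaussian -(integral_radial t0 (sqdist_ge0 c y)) -ge0_integralZl//.
  - by apply: eq_integral => r _; rewrite /F /= normrM (ger0_norm (radial_ge0 _ _ t0)).
  - by apply/measurable_EFinP; exact: measurable_radial (sqdist_ge0 c y).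
  - by move=> r _; rewrite lee_fin radial_ge0.
have FE y : (\int[lebesgue_measure]_r F (y, r) = (f y * gaussian t c y)%:E)%E.
  rewrite EFinM /gaussian -(integral_radial t0 (sqdist_ge0 c y)) -integralZl//.
  exact: (integrable_radial t0 (sqdist_ge0 c y)).
have GE : {ae lebesgue_measure, forall r, (\int[@vol3 R]_y F (y, r) = 0)%E}.
  apply: filterS ball0 => r Hr; have [r0|r0] := ltP 0 r; last first.
    apply: integral0_eq => y _; rewrite /F /= indicE memNset ?mulr0//.
    by move=> [r1 _]; move: r0; rewrite leNgt r1.
  have iB := integrable_eball c sf r0.
  transitivity
    (\int[@leb3 R]_y ((radial_density t r)%:E * (f y * \1_(eball (c, 0) r) y)%:E))%E.
    by apply: eq_integral => y _; rewrite /F /= radial_indic// -EFinM mulrCA.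
  rewrite integralZl// (integral_EFin_eq0 iB) ?mule0//.
  by rewrite -[RHS](Hr r0) [RHS]Rintegral_indic.
have := Fubini iF; under eq_integral => y _ do rewrite FE.
rewrite [X in _ = X -> _](_ : _ = 0)%E; last first.
  rewrite (@ae_eq_integral _ _ _ _ setT (cst 0%E))//.
  - by rewrite integral0.
  - exact: (measurable_fubini_G iF).
  - by apply: filterS GE => r E _; exact: E.
by rewrite /Rintegral => ->.
Qed.

End Radial.

(** * From almost every centre to every centre *)

Section Centers.
Context {R : realType}.
Implicit Types (f : R3 R -> R) (c : R * R) (t : R).

Lemma cvg_dist_harmonic (u : nat -> R) (l K : R) :
  (forall n, `|u n - l| <= K * n.+1%:R^-1) -> u @ \oo --> l.
Proof.
move=> uK; apply/cvgrPdist_le => e e0.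
have K0 : 0 < `|K| + 1 by rewrite ltr_wpDl.
have [n0 _ n0P] := near_infty_natSinv_lt (PosNum (divr_gt0 e0 K0)).
exists n0 => // n /= /n0P /= ne; rewrite distrC (le_trans (uK n))//.
have n1 : 0 < n.+1%:R^-1 :> R by rewrite invr_gt0.
move: ne; rewrite ltr_pdivlMr// => /ltW; apply: le_trans.
by rewrite mulrC ler_wpM2l ?(ltW n1)// (le_trans (ler_norm K))// lerDl.
Qed.

(** Applied to the data, whose last coordinate is the radius. *)
Lemma leb3_ae_sections (P : R3 R -> Prop) : {ae leb3, forall p, P p} ->
  {ae @leb2 R, forall c, {ae lebesgue_measure, forall r, P (c, r)}}.
Proof.
move=> [N [mN N0 PN]].
have mX : measurable_fun setT (lebesgue_measure \o xsection N).
  exact: measurable_fun_xsection.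
have : (\int[@leb2 R]_c `|(lebesgue_measure \o xsection N) c| = 0)%E.
  rewrite -[RHS]N0; apply: eq_integral => c _.
  by rewrite gee0_abs//; exact: measure_ge0.
move/(ae_eq_integral_abs _ measurableT mX); apply: filterS => c /(_ Logic.I) /= Nc.
exists (xsection N c); split => //; first exact: measurable_xsection.
by move=> r /= nP; rewrite /xsection /= inE; exact: PN.
Qed.

Lemma ae_leb2_dense (P : R * R -> Prop) c (e : R) : 0 < e ->
  {ae @leb2 R, forall c, P c} ->
  exists c', [/\ P c', `|c'.1 - c.1| <= e & `|c'.2 - c.2| <= e].
Proof.
move=> e0 [N [mN N0 PN]]; apply: contrapT => nex.
pose I a : set R := `[a - e, a + e]%classic.
have Ie a : lebesgue_measure (I a) = (e *+ 2)%:E.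
  rewrite lebesgue_measure_itv /= lte_fin ifT; first by rewrite -EFinB; congr EFin; ring.
  by rewrite ltrBlDr -addrA ltrDl addr_gt0.
have IN : I c.1 `*` I c.2 `<=` N.
  move=> [x y] []; rewrite /I /= !in_itv/= => /andP[h1 h2] /andP[h3 h4].
  apply: PN => Pxy; apply: nex; exists (x, y); split => //=.
    by rewrite ler_norml; apply/andP; split; lra.
  by rewrite ler_norml; apply/andP; split; lra.
have : (@leb2 R (I c.1 `*` I c.2) <= @leb2 R N)%E.
  by apply: le_measure => //; rewrite inE//; apply: measurableX; exact: measurable_itv.
rewrite N0 [X in (X <= _)%E](_ : _ = (e *+ 2)%:E * (e *+ 2)%:E)%E; last first.
  transitivity (lebesgue_measure (I c.1) * lebesgue_measure (I c.2))%E.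
    by apply: product_measure1E; exact: measurable_itv.
  by rewrite !Ie.
by rewrite -EFinM lee_fin leNgt mulr_gt0// mulrn_wgt0.
Qed.

(** From (x - a')^2 >= (x - a)^2 / 2 - (a' - a)^2. It bounds Gaussians with nearby
    centres by one fixed Gaussian. *)
Lemma sqdist_near c c' (y : R3 R) : `|c'.1 - c.1| <= 1 -> `|c'.2 - c.2| <= 1 ->
  sqdist c y / 2 - 2 <= sqdist c' y.
Proof.
rewrite !ler_norml /sqdist => /andP[a1 a2] /andP[b1 b2].
have H (x a a' : R) : -1 <= a' - a -> a' - a <= 1 -> (x - a) ^+ 2 / 2 - 1 <= (x - a') ^+ 2.
  move=> h1 h2; have : (a' - a) ^+ 2 <= 1 by nra.
  have := sqr_ge0 (x - a - 2 * (a' - a)); nra.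
have := H y.1.1 _ _ a1 a2; have := H y.1.2 _ _ b1 b2; have := sqr_ge0 y.2; lra.
Qed.

(** A set of full measure is dense, and the Gaussian integral depends continuously
    on the centre, by domination. *)
Lemma gaussian_ae_all f : square_integrable leb3 f ->
  {ae @leb2 R, forall c, forall t, 0 < t -> \int[leb3]_y (f y * gaussian t c y) = 0} ->
  forall c t, 0 < t -> \int[leb3]_y (f y * gaussian t c y) = 0.
Proof.
move=> sf fae c t t0.
have e0 n : 0 < n.+1%:R^-1 :> R by rewrite invr_gt0.
have /choice[c_ c_P] n := ae_leb2_dense c (e0 n) fae.
have cvg1 : (c_ n).1 @[n --> \oo] --> c.1.
  by apply: (@cvg_dist_harmonic _ _ 1) => n; rewrite mul1r; have [] := c_P n.
have cvg2 : (c_ n).2 @[n --> \oo] --> c.2.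
  by apply: (@cvg_dist_harmonic _ _ 1) => n; rewrite mul1r; have [] := c_P n.
have e1 n : n.+1%:R^-1 <= 1 :> R by rewrite invf_le1// ler1n.
apply: (@Rdominated_eq0 _ _ R leb3 (fun n y => f y * gaussian t (c_ n) y) _
  (fun y => expR (t * 2) * `|f y * gaussian (t / 2) c y|)).
- by move=> n; apply: measurable_funM; [exact: sf.1|exact: measurable_gaussian].
- move=> y; apply: cvgM; first exact: cvg_cst.
  apply: (@cvg_comp _ _ _ (fun n => - (t * sqdist (c_ n) y)) expR).
    2: exact: continuous_expR.
  rewrite /sqdist; apply: cvgN; apply: cvgM; first exact: cvg_cst.
  apply: cvgD; last exact: cvg_cst.
  by apply: cvgD; rewrite expr2; under eq_fun do rewrite expr2;
    apply: cvgM; (apply: cvgB; [exact: cvg_cst|]).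
- apply: (@integrableZl _ _ R leb3 setT measurableT _
    (EFin \o (fun y => `|f y * gaussian (t / 2) c y|))).
  by apply: (integrable_norm (integrable_mul_gaussian c sf _)); rewrite divr_gt0.
- move=> n y; rewrite !normrM mulrCA ler_wpM2l//.
  rewrite !(ger0_norm (ltW (gaussian_gt0 _ _ _))) /gaussian -expRD ler_expR.
  have [_ h1 h2] := c_P n.
  have := sqdist_near y (le_trans h1 (e1 n)) (le_trans h2 (e1 n)).
  by move=> H; nra.
- by move=> n; have [->] := c_P n.
Qed.

End Centers.

(** * Even functions orthogonal to the planar Gaussians *)

Section Cutset.
Context {R : realType}.
Implicit Types (c : R * R) (y : R3 R) (t s q : R).

Lemma bernoulli_lower (x : R) n : 0 <= x <= 1 -> 1 - n%:R * x <= (1 - x) ^+ n.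
Proof.
move=> /andP[x0 x1]; elim: n => [|n IH]; first by rewrite mul0r subr0.
have := ler_wpM2r (_ : 0 <= 1 - x) IH; rewrite subr_ge0 => /(_ x1).
rewrite -exprSr; apply: le_trans; rewrite -natr1.
have : 0 <= n%:R :> R by []. nra.
Qed.

Lemma bernoulli_upper (x : R) n : 0 <= x <= 1 -> (1 - x) ^+ n * (1 + n%:R * x) <= 1.
Proof.
move=> /andP[x0 x1]; elim: n => [|n IH]; first by rewrite mul0r addr0 mulr1.
apply: le_trans IH; rewrite exprSr -mulrA; apply: ler_wpM2l.
  by rewrite exprn_ge0 ?subr_ge0.
rewrite -natr1; have : 0 <= n%:R :> R by []. nra.
Qed.

(** Completing the square: the centre of the product is a weighted mean of the two
    centres, so it lies on the plane again. *)
Lemma gaussianM t s c c' : 0 < t -> 0 < s -> exists K c'', forall y,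
  gaussian t c y * gaussian s c' y = K * gaussian (t + s) c'' y.
Proof.
move=> t0 s0; have ts : t + s != 0 by rewrite gt_eqF// addr_gt0.
exists (expR (- (t * s / (t + s) * ((c.1 - c'.1) ^+ 2 + (c.2 - c'.2) ^+ 2)))).
exists ((t * c.1 + s * c'.1) / (t + s), (t * c.2 + s * c'.2) / (t + s)) => y.
rewrite /gaussian -!expRD /sqdist /=; congr expR.
by field.
Qed.

(** A polynomial in a Gaussian approximating the indicator of the exterior of the
    ball of squared radius [q]. With X = (n+1) exp((n+1) (q - sqdist c y)), which is
    small outside the ball and large inside, it is (1 - X/N)^N; the integer N
    exceeds the maximum of X, which keeps 1 - X/N in the interval from 0 to 1. *)
Definition soft_threshold (c : R * R) q n y : R :=
  let a := n.+1%:R * expR (n.+1%:R * q) in let N := (Num.truncn a).+1 in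
  (1 - a / N%:R * gaussian n.+1%:R c y) ^+ N.

(** Both estimates are Bernoulli inequalities: 1 - X <= (1 - X/N)^N and
    (1 - X/N)^N <= 1 / (1 + X). *)
Lemma soft_threshold_bounds c q n y :
  let X := n.+1%:R * expR (n.+1%:R * (q - sqdist c y)) in
  [/\ 0 <= soft_threshold c q n y, soft_threshold c q n y <= 1,
      1 - X <= soft_threshold c q n y & soft_threshold c q n y * (1 + X) <= 1].
Proof.
move=> X; rewrite /soft_threshold; set a := _ * expR _; set N := (Num.truncn a).+1.
set x := _ * gaussian _ _ _.
have a0 : 0 < a by rewrite mulr_gt0// expR_gt0.
have N0 : 0 < N%:R :> R by [].
have aN : a / N%:R <= 1 by rewrite ler_pdivrMr// mul1r ltW// truncnS_gt.
have x0 : 0 <= x by rewrite mulr_ge0 ?divr_ge0 ?(ltW a0) ?(ltW (gaussian_gt0 _ _ _)).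
have x1 : x <= 1.
  rewrite -[leRHS]mulr1; apply: ler_pM => //; first by rewrite divr_ge0// ltW.
    by rewrite ltW// gaussian_gt0.
  exact: gaussian_le1.
have NxX : N%:R * x = X.
  rewrite /x mulrA mulrCA divff ?gt_eqF// mulr1 /X /a /gaussian -mulrA -expRD.
  by congr (_ * expR _); ring.
have x01 : 0 <= x <= 1 by rewrite x0.
split.
- by rewrite exprn_ge0// subr_ge0.
- by rewrite exprn_ile1 ?subr_ge0// lerBlDr lerDl.
- by rewrite -NxX bernoulli_lower.
- by rewrite -NxX bernoulli_upper.
Qed.

Lemma soft_threshold_cvg c q y :
  soft_threshold c q n y @[n --> \oo] --> (\1_[set z | q < sqdist c z] y : R).
Proof.
have n0 n : 0 < n.+1%:R :> R by [].
have [qy|yq] := ltP q (sqdist c y).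
  rewrite indicE mem_set//; have [C [C0 hC]] := poly_expR_bounded ('X^2 : {poly R}).
  (* For d = sqdist c y - q, the bound (n+1)^2 d^2 exp(-(n+1) d) <= C makes X of
     order 1/(n+1). *)
  pose d := sqdist c y - q; have d0 : 0 < d by rewrite subr_gt0.
  apply: (@cvg_dist_harmonic _ _ _ (C / d ^+ 2)) => n.
  have [_ h1 h2 _] := soft_threshold_bounds c q n y.
  rewrite ler0_norm ?subr_le0// opprB lerBlDr addrC -lerBlDr (le_trans _ h2)//.
  rewrite lerB// ler_pdivlMr//.
  have := hC (n.+1%:R * d); rewrite mulr_ge0 ?(ltW d0)// => /(_ isT).
  rewrite hornerXn ger0_norm ?mulr_ge0 ?expR_ge0 ?exprn_ge0 ?mulr_ge0 ?(ltW d0)//.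
  rewrite ler_pdivlMr ?exprn_gt0//; apply: le_trans.
  have -> : q - sqdist c y = - d by rewrite opprB.
  by rewrite mulrN le_eqVlt; apply/orP; left; apply/eqP; ring.
rewrite indicE memNset; last by rewrite /= => /lt_geF; rewrite yq.
apply: (@cvg_dist_harmonic _ _ _ 1) => n; rewrite mul1r subr0.
have [h0 _ _ h3] := soft_threshold_bounds c q n y; rewrite ger0_norm//.
rewrite -[leRHS]mul1r ler_pdivlMr//; apply: le_trans h3; rewrite ler_wpM2l//.
rewrite ler_wpDl// -[leLHS]mulr1 ler_wpM2l// -expR0 ler_expR.
by rewrite mulr_ge0// subr_ge0.
Qed.

(** Gaussians with centre on the plane are stable under products, so the exteriors
    of balls centred on the plane can be cut out. The functions [sqdist c]
    determine y1, y2 and |y3|, and an even [f] is a function of these. *)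
Lemma even_eq0_gaussian (f : R3 R -> R) : square_integrable leb3 f ->
  (forall y, f (reflect3 y) = f y) ->
  (forall c t, 0 < t -> \int[leb3]_y (f y * gaussian t c y) = 0) ->
  {ae leb3, forall y, f y = 0}.
Proof.
move=> sf feven f0.
pose Phi := [set phi : R3 R -> R | exists t c, 0 < t /\ phi = gaussian t c].
have iPhi phi : Phi phi -> leb3.-integrable setT (EFin \o (f \* phi)).
  by move=> [t [c [t0 ->]]]; exact: integrable_mul_gaussian.
have a1 : annihilates leb3 f Phi (cst 1).
  split; first by split; [exact: measurable_cst|exists 1 => x; rewrite normr1].
  by move=> phi [t [c [t0 ->]]]; under eq_Rintegral do rewrite mulr1; exact: f0.
have bG t c : 0 <= t -> bounded_measurable (gaussian t c).
  move=> t0; split; first exact: measurable_gaussian.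
  by exists 1 => y; rewrite ger0_norm ?gaussian_le1// ltW// gaussian_gt0.
have aG h t c : 0 < t -> annihilates leb3 f Phi h ->
    annihilates leb3 f Phi (h \* gaussian t c).
  move=> t0 [bh h0]; split; first exact: (bounded_measurableM bh (bG _ _ (ltW t0))).
  move=> _ [s [c' [s0 ->]]]; have [K [c'' E]] := gaussianM c' c s0 t0.
  have PG : Phi (gaussian (s + t) c'') by exists (s + t), c''; rewrite addr_gt0.
  rewrite -[RHS](mulr0 K) -[in RHS](h0 _ PG) -RintegralZl//; last first.
    exact: (@integrable_bounded_mul _ _ R leb3 f Phi iPhi _ _ PG bh).
  apply: eq_Rintegral => y _ /=.
  transitivity (f y * h y * (gaussian s c' y * gaussian t c y)); first by ring.
  by rewrite E; ring.
have aT h c q n : annihilates leb3 f Phi h ->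
    annihilates leb3 f Phi (h \* soft_threshold c q n).
  move=> ah; suff aP b N :
      annihilates leb3 f Phi (h \* (fun y => (1 - b * gaussian n.+1%:R c y) ^+ N)).
    exact: aP.
  elim: N => [|k IH].
    by move: ah; congr annihilates; apply/funext => y /=; rewrite expr0 mulr1.
  have aZ := @annihilatesZ _ _ R leb3 f Phi iPhi (- b) _ (aG _ _ c (ltr0Sn R n) IH).
  have := @annihilatesD _ _ R leb3 f Phi iPhi _ _ IH aZ.
  by congr annihilates; apply/funext => y /=; rewrite exprSr; ring.
have sG : sigma_algebra setT (cut_stable leb3 f Phi) by exact: cut_stable_sigma_algebra.
have cball c q : cut_stable leb3 f Phi [set y | q < sqdist c y].
  have bT n y : `|soft_threshold c q n y| <= 1.
    by have [h0 h1 _ _] := soft_threshold_bounds c q n y; rewrite ger0_norm.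
  apply: (@cut_stable_lim _ _ R leb3 f Phi iPhi (soft_threshold c q) 1) => //.
  - exact: measurable_superlevel (measurable_sqdist c).
  - move=> n; split; last by exists 1.
    apply: measurable_funX; apply: measurable_funB => //.
    by apply: measurable_funM => //; exact: measurable_gaussian.
  - by move=> h n; exact: aT.
  - by move=> y; exact: soft_threshold_cvg.
pose W := g_sigma_algebraType (cut_stable leb3 f Phi).
have mS c : measurable_fun setT (sqdist c : W -> R) := measurable_fun_rays (cball c).
pose X1 y : R := (sqdist (0, 0) y - sqdist (1, 0) y + 1) / 2.
pose X2 y : R := (sqdist (0, 0) y - sqdist (0, 1) y + 1) / 2.
pose X3 y : R := Num.sqrt (sqdist (0, 0) y - X1 y ^+ 2 - X2 y ^+ 2).
have mX1 : measurable_fun setT (X1 : W -> R).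
  by apply: measurable_funM => //; apply: measurable_funD => //; exact: measurable_funB.
have mX2 : measurable_fun setT (X2 : W -> R).
  by apply: measurable_funM => //; apply: measurable_funD => //; exact: measurable_funB.
have mX3 : measurable_fun setT (X3 : W -> R).
  apply: (@measurableT_comp _ _ _ _ _ _ (@Num.sqrt R)).
    by apply: continuous_measurable_fun; exact: sqrt_continuous.
  apply: measurable_funB; last exact: measurable_funX.
  by apply: measurable_funB; [exact: mS|exact: measurable_funX].
have fX y : f (X1 y, X2 y, X3 y) = f y.
  have E1 : X1 y = y.1.1 by rewrite /X1 /sqdist /=; field.
  have E2 : X2 y = y.1.2 by rewrite /X2 /sqdist /=; field.
  have E3 : X3 y = `|y.2|.
    by rewrite /X3 E1 E2 -sqrtr_sqr; congr Num.sqrt; rewrite /sqdist /=; ring.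
  rewrite E1 E2 E3; case: y {E1 E2 E3} => [[y1 y2] y3] /=.
  by have [_|_] := ger0P y3; rewrite // -(feven (y1, y2, y3)).
have mG (A : set (R3 R)) : measurable A ->
    cut_stable leb3 f Phi [set y | A (X1 y, X2 y, X3 y)].
  by move=> mA; exact: (sigma_algebra_preimage3 sG mX1 mX2 mX3 mA).
have cpos : cut_stable leb3 f Phi [set y | 0 < f y].
  have := mG _ (measurable_superlevel 0 sf.1).
  by congr cut_stable; apply/seteqP; split => y /=; rewrite fX.
have cneg : cut_stable leb3 f Phi [set y | f y < 0].
  have := mG _ (measurable_sublevel 0 sf.1).
  by congr cut_stable; apply/seteqP; split => y /=; rewrite fX.
have PG : Phi (gaussian 1 (0, 0)) by exists 1, (0, 0).
have := @cut_stable_ae_eq0 _ _ R leb3 f Phi iPhi _ a1 cpos cneg PG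
  (fun y => ltW (gaussian_gt0 1 (0, 0) y)).
apply: filterS => y /eqP; rewrite mulf_eq0 => /orP[/eqP//|].
by rewrite gt_eqF// gaussian_gt0.
Qed.

End Cutset.

(** * Data and divergence *)

Section Main.
Context {R : realType}.
Implicit Types (f g : R3 R -> R) (u : R3 R -> R3 R).

#[global] Instance leb2_ae_filter : Filter (nbhs (almost_everywhere (@leb2 R))).
Proof. exact: ae_filter_ringOfSetsType. Qed.

Lemma forward_eqE u1 u2 (p : R3 R) : sobolevH1 u1 -> sobolevH1 u2 -> 0 < p.2 ->
  forward u1 p = forward u2 p <->
  \int[leb3]_(y in eball (p.1, 0) p.2) (weak_div u1 y - weak_div u2 y) = 0.
Proof.
move=> /weak_div_L2/L2_square_integrable s1 /weak_div_L2/L2_square_integrable s2 p0.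
have -> : \int[leb3]_(y in eball (p.1, 0) p.2) (weak_div u1 y - weak_div u2 y) =
    \int[leb3]_(y in eball (p.1, 0) p.2) weak_div u1 y -
    \int[leb3]_(y in eball (p.1, 0) p.2) weak_div u2 y.
  rewrite !(Rintegral_indic leb3 (eball _ _)) -RintegralB//; [|exact: integrable_eball..].
  by apply: eq_Rintegral => y _; rewrite mulrBl.
rewrite /forward; split => [|/subr0_eq ->//].
have p4 : - (p.2 ^+ 4)^-1 != 0 by rewrite oppr_eq0 invr_eq0 expf_neq0// gt_eqF.
by move=> /(mulfI p4) ->; rewrite subrr.
Qed.

(** The Gaussian argument needs a function that is even everywhere, hence the
    symmetrization of [f], which agrees with it almost everywhere. *)
Lemma eq0_of_eball f : square_integrable leb3 f ->
  {ae leb3, forall y, f (reflect3 y) = f y} ->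
  {ae leb3, forall p, 0 < p.2 -> \int[leb3]_(y in eball (p.1, 0) p.2) f y = 0} ->
  {ae leb3, forall y, f y = 0}.
Proof.
move=> sf feven fball.
have fG c t : 0 < t -> \int[leb3]_y (f y * gaussian t c y) = 0.
  move: c t; apply: (gaussian_ae_all sf).
  apply: filterS (leb3_ae_sections fball) => c Hc t t0.
  exact: gaussian_of_eball.
(* This is (f y + f (reflect3 y)) / 2, written so that its agreement with [f] is
   read off directly. *)
pose g y := f y - (f y - f (reflect3 y)) / 2.
have gf : {ae leb3, forall y, g y = f y}.
  by apply: filterS feven => y E; rewrite /g E subrr mul0r subr0.
have mg : measurable_fun setT g.
  apply: measurable_funB; first exact: sf.1.
  apply: measurable_funM => //; apply: measurable_funB; first exact: sf.1.
  exact: (measurableT_comp sf.1 measurable_reflect3).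
have sg : square_integrable leb3 g.
  split => //; have [mf2 fy] := integrableP _ _ _ sf.2; apply/integrableP; split.
    by apply/measurable_EFinP; exact: measurable_funX.
  apply: le_lt_trans fy; rewrite le_eqVlt; apply/orP; left; apply/eqP.
  apply: ae_eq_integral => //.
  - by apply: measurableT_comp => //; apply/measurable_EFinP; exact: measurable_funX.
  - exact: measurableT_comp.
  - by apply: filterS gf => y E _ /=; rewrite E.
have : {ae leb3, forall y, g y = 0}.
  apply: even_eq0_gaussian => //.
    by move=> y; rewrite /g reflect3K; field.
  move=> c t t0; rewrite -[RHS](fG c t t0); apply: (@ae_eq_Rintegral _ _ R leb3).
  - by apply: measurable_funM => //; exact: measurable_gaussian.
  - by apply: measurable_funM; [exact: sf.1|exact: measurable_gaussian].
  - by apply: filterS gf => y ->.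
by apply: filterS2 gf => y -> .
Qed.

End Main.

Unset Implicit Arguments.

Theorem corollary3p3 (R : realType) (u1 u2 : R * R * R -> R * R * R)
    (hu1 : sobolevH1e u1) (hu2 : sobolevH1e u2) :
  forward u1 = forward u2 %[ae leb3 in data_domain] <->
  weak_div (u1 \- u2) = (fun=> 0) %[ae leb3].
Proof.
have [h1 _] := hu1; have [h2 _] := hu2.
pose f := weak_div u1 \- weak_div u2.
have wf := weak_divB h1 h2.
have sf : square_integrable leb3 f.
  by apply: square_integrableB; apply: L2_square_integrable; exact: weak_div_L2.
split => [data|w0].
  have f0 : {ae leb3, forall y, f y = 0}.
    apply: (eq0_of_eball sf).
      by apply: filterS2 (weak_div_even hu1) (weak_div_even hu2) => y E1 E2;
        rewrite /f /= E1 E2.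
    by apply: filterS data => p Hp p0; apply/(forward_eqE h1 h2 p0); exact: Hp.
  by apply: filterS2 wf f0 => y -> E _; exact: E.
have f0 : {ae leb3, forall y, f y = 0}.
  by apply: filterS2 wf w0 => y E1 E2; rewrite /f /= -E1 E2.
apply: filterE => p p0; apply/(forward_eqE h1 h2 p0).
rewrite [LHS]Rintegral_indic; have B := measurable_eball p.1 p0.
rewrite (@ae_eq_Rintegral _ _ R leb3 _ (cst 0)).
- by rewrite /Rintegral integral0.
- by apply: measurable_funM; [exact: sf.1|exact: measurable_indic].
- exact: measurable_cst.
- by apply: filterS f0 => y E; rewrite /= -[_ - _]/(f y) E mul0r.
Qed.
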